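(* Let $\mathcal{C}$ be a small strict monoidal braided Ab-category with left duality, with braiding $c$, let $S_0$ be an infinite set, and let $\mathcal{C}^{S_0}$ be the associated (nonstrict) braided monoidal category (defined in the context). Let $S_h\subset S_0$ and let $h:S_h\to \mathrm{Obj}(\mathcal{C})$ be an injective function such that $\mathrm{I}\in h(S_h)$ and $h(S_h)$ is closed under $\otimes$, i.e. for every $(x,y)\in S_h\times S_h$ there is a (unique) $z\in S_h$ with $h(x)\otimes h(y)=h(z)$. Let $\Delta_h=\{(x,x)\mid x\in S_h\}$ and let $\overline{\mathrm{h}}$ be the object of $\mathcal{C}^{S_0}$ given by $\overline{\mathrm{h}}:\gamma(\Delta_h)\to \mathrm{Obj}(\mathcal{C})$, $\overline{\mathrm{h}}(\gamma(x,x))=h(x)^{\ast}\otimes h(x)$. Then the object $\overline{\mathrm{h}}$ is a bialgebra in $\mathcal{C}^{S_0}$ (that is, it admits morphisms $\mu,\eta,\Delta,\varepsilon$ making it one), and the objects of $\mathcal{C}$, considered as objects $J(V)$ of $\mathcal{C}^{S_0}$, are $\overline{\mathrm{h}}$-modules.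
   Context: An Ab-category is a category whose hom-sets are additive abelian groups with bilinear composition; in a monoidal Ab-category the tensor product of morphisms is also assumed bilinear. Left duality in a strict monoidal category: every object $V$ has a chosen object $V^\ast$ and morphisms $b_V:\mathrm{I}\to V\otimes V^\ast$, $d_V:V^\ast\otimes V\to \mathrm{I}$ with $(\mathrm{id}_V\otimes d_V)(b_V\otimes \mathrm{id}_V)=\mathrm{id}_V$ and $(d_V\otimes \mathrm{id}_{V^\ast})(\mathrm{id}_{V^\ast}\otimes b_V)=\mathrm{id}_{V^\ast}$. The category $\mathcal{C}^{S_0}$. Objects are functions $f:S_f\to \mathrm{Obj}(\mathcal{C})$ with $S_f\subset S_0$ any subset. A morphism $F:f\to g$ is a function on $S_f\times S_g$ assigning to $(x,y)$ a morphism $F(x,y):f(x)\to g(y)$ of $\mathcal{C}$ such that, if $S_g$ is infinite, for each $x\in S_f$ there is a finite set $S^F_x\subset S_g$ with $F(x,y)=0$ for $y\in S_g\setminus S_x^F$. Composition is $(G\circ F)(x,y)=\sum_{z\in S_g}G(z,y)\circ F(x,z)$; identities are $\mathrm{Id}_f(x,y)=\delta_{x,y}\mathrm{id}_{f(x)}$ (here and below, $\delta$ times a morphism means that morphism when the indices agree and the zero morphism otherwise). Monoidal structure. Fix a bijection $\gamma:S_0\times S_0\to S_0$ and a point $\ast\in S_0$. For objects $f,g$, $f\otimes g:\gamma(S_f\times S_g)\to\mathrm{Obj}(\mathcal{C})$ is $(f\otimes g)(\gamma(x,y))=f(x)\otimes g(y)$. The unit object is $\mathrm{I}:\{\ast\}\to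 \mathrm{Obj}(\mathcal{C})$, $\ast\mapsto \mathrm{I}$. For morphisms $F:f\to f'$, $G:g\to g'$, $(F\otimes G)(\gamma(x,y),\gamma(x',y'))=F(x,x')\otimes G(y,y')$. The associativity constraint $A_{f,g,k}:(f\otimes g)\otimes k\to f\otimes(g\otimes k)$ is $A_{f,g,k}(\gamma(\gamma(x,y),z),\gamma(x',\gamma(y',z')))=\delta_{x,x'}\delta_{y,y'}\delta_{z,z'}\mathrm{id}_{f(x)\otimes g(y)\otimes k(z)}$; the units $R_f:f\otimes\mathrm{I}\to f$, $L_f:\mathrm{I}\otimes f\to f$ are $R_f(\gamma(x,\ast),x')=\delta_{x,x'}\mathrm{id}_{f(x)}$, $L_f(\gamma(\ast,x),x')=\delta_{x,x'}\mathrm{id}_{f(x)}$. The braiding $C_{f,g}:f\otimes g\to g\otimes f$ is $C_{f,g}(\gamma(x,y),\gamma(y',x'))=\delta_{x,x'}\delta_{y,y'}c_{f(x),g(y)}$. Objects of $\mathcal{C}$ in $\mathcal{C}^{S_0}$: for each object $V$ of $\mathcal{C}$ choose any point $x_V\in S_0$ and let $J(V):\{x_V\}\to \mathrm{Obj}(\mathcal{C})$, $x_V\mapsto V$; for $\alpha:V\to W$ let $J(\alpha)(x_V,x_W)=\alpha$. The relation $\doteq$. In a monoidal category with associativity constraint $A$ and units $R,L$, let $\mathcal{A}$ be the set of isomorphisms generated under tensor products and compositions by all identities and all components of $A^{\pm1},R^{\pm1},L^{\pm1}$. For morphisms $F,G$ write $F\doteq G$ if $G=X\circ F\circ Y$ for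 some $X,Y\in\mathcal{A}$. Algebras etc. in a (nonstrict) monoidal category $\mathbf{V}$. An algebra is an object $H$ with morphisms $\mu:H\otimes H\to H$, $\eta:\mathrm{I}\to H$ such that $\mu(\mu\otimes\mathrm{id}_H)\doteq\mu(\mathrm{id}_H\otimes\mu)$ and $\mu(\eta\otimes\mathrm{id}_H)\doteq\mathrm{id}_H\doteq\mu(\mathrm{id}_H\otimes\eta)$. A coalgebra is an object $H$ with morphisms $\Delta:H\to H\otimes H$, $\varepsilon:H\to\mathrm{I}$ such that $(\Delta\otimes\mathrm{id}_H)\Delta\doteq(\mathrm{id}_H\otimes\Delta)\Delta$ and $(\varepsilon\otimes\mathrm{id}_H)\Delta\doteq\mathrm{id}_H\doteq(\mathrm{id}_H\otimes\varepsilon)\Delta$. If $\mathbf{V}$ is braided with braiding $c$ and $H$ is an algebra, the product $\widehat{\mu}$ of $H\otimes H$ is the composite $$\widehat\mu=(\mu\otimes\mu)\circ A_{H\otimes H,H,H}\circ(A^{-1}_{H,H,H}\otimes\mathrm{id}_H)\circ((\mathrm{id}_H\otimes c_{H,H})\otimes\mathrm{id}_H)\circ(A_{H,H,H}\otimes\mathrm{id}_H)\circ A^{-1}_{H\otimes H,H,H}$$ from $(H\otimes H)\otimes(H\otimes H)$ to $H\otimes H$. A bialgebra is an object $H$ that is an algebra and a coalgebra such that $\widehat\mu(\Delta\otimes\Delta)\doteq\Delta\mu$ and $\varepsilon\mu\doteq\varepsilon\otimes\varepsilon$. If $H$ is an algebra, an object $V$ is an $H$-module if there is a morphism $T:H\otimes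 V\to V$ with $T(\mu\otimes\mathrm{id}_V)\doteq T(\mathrm{id}_H\otimes T)$ and $T(\eta\otimes\mathrm{id}_V)\doteq\mathrm{id}_V$. *)

(* Defs.v *)
From HB Require Import structures.
From mathcomp Require Import all_boot all_order all_algebra.
From mathcomp Require Import all_classical.

Set Implicit Arguments.
Unset Strict Implicit.
Unset Printing Implicit Defensive.

Import GRing.Theory.
Local Open Scope ring_scope.
Local Open Scope classical_set_scope.

Declare Scope moncat_scope.
Delimit Scope moncat_scope with mc.
Local Open Scope moncat_scope.

Record category := Category {
  obj :> Type;
  mor : obj -> obj -> Type;
  idm : forall a, mor a a;
  compm : forall a b c, mor b c -> mor a b -> mor a c;
  compmA : forall a b c d (h : mor c d) (g : mor b c) (f : mor a b),
    compm h (compm g f) = compm (compm h g) f;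
  comp1m : forall a b (f : mor a b), compm (idm b) f = f;
  compm1 : forall a b (f : mor a b), compm f (idm a) = f
}.

Arguments mor {_} _ _.
Arguments idm {_} _.
Arguments compm {_ _ _ _} _ _.

Notation "g ∘ f" := (compm g f) (at level 45, left associativity) : moncat_scope.

Record monoidal := Monoidal {
  mcat :> category;
  munit : mcat;
  tenso : mcat -> mcat -> mcat;
  tensm : forall a a' b b', mor a a' -> mor b b' ->
    mor (tenso a b) (tenso a' b');
  assoc : forall a b c, mor (tenso (tenso a b) c) (tenso a (tenso b c));
  associ : forall a b c, mor (tenso a (tenso b c)) (tenso (tenso a b) c);
  runit : forall a, mor (tenso a munit) a;
  runiti : forall a, mor a (tenso a munit);
  lunit : forall a, mor (tenso munit a) a;
  luniti : forall a, mor a (tenso munit a);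
  tensm1 : forall a b, tensm (idm a) (idm b) = idm (tenso a b);
  tensm_comp : forall a a' a'' b b' b'' (f' : mor a' a'') (f : mor a a')
      (g' : mor b' b'') (g : mor b b'),
    tensm (f' ∘ f) (g' ∘ g) = tensm f' g' ∘ tensm f g;
  assocK : forall a b c, associ a b c ∘ assoc a b c = idm _;
  associK : forall a b c, assoc a b c ∘ associ a b c = idm _;
  runitK : forall a, runiti a ∘ runit a = idm _;
  runitiK : forall a, runit a ∘ runiti a = idm _;
  lunitK : forall a, luniti a ∘ lunit a = idm _;
  lunitiK : forall a, lunit a ∘ luniti a = idm _;
  assoc_nat : forall a a' b b' c c'
      (f : mor a a') (g : mor b b') (h : mor c c'),
    assoc a' b' c' ∘ tensm (tensm f g) h =
    tensm f (tensm g h) ∘ assoc a b c;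
  runit_nat : forall a a' (f : mor a a'),
    runit a' ∘ tensm f (idm munit) = f ∘ runit a;
  lunit_nat : forall a a' (f : mor a a'),
    lunit a' ∘ tensm (idm munit) f = f ∘ lunit a;
  pentagon : forall a b c d,
    assoc a b (tenso c d) ∘ assoc (tenso a b) c d =
    tensm (idm a) (assoc b c d) ∘ assoc a (tenso b c) d ∘
      tensm (assoc a b c) (idm d);
  triangle : forall a b,
    tensm (idm a) (lunit b) ∘ assoc a munit b = tensm (runit a) (idm b)
}.

Arguments munit {_}.
Arguments tenso {_} _ _.
Arguments tensm {_ _ _ _ _} _ _.
Arguments assoc {_} _ _ _.
Arguments associ {_} _ _ _.
Arguments runit {_} _.
Arguments runiti {_} _.
Arguments lunit {_} _.
Arguments luniti {_} _.

Notation "a ⊗ b" := (tenso a b) (at level 40, left associativity) : moncat_scope.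
Notation "f ⊠ g" := (tensm f g) (at level 40, left associativity) : moncat_scope.

Record braided := Braided {
  bmon :> monoidal;
  braid : forall a b : bmon, mor (a ⊗ b) (b ⊗ a);
  braidi : forall a b : bmon, mor (b ⊗ a) (a ⊗ b);
  braidK : forall a b, braidi a b ∘ braid a b = idm _;
  braidiK : forall a b, braid a b ∘ braidi a b = idm _;
  braid_nat : forall (a a' b b' : bmon) (f : mor a a') (g : mor b b'),
    braid a' b' ∘ (f ⊠ g) = (g ⊠ f) ∘ braid a b;
  hexagon1 : forall a b c : bmon,
    assoc b c a ∘ braid a (b ⊗ c) ∘ assoc a b c =
    (idm b ⊠ braid a c) ∘ assoc b a c ∘ (braid a b ⊠ idm c);
  hexagon2 : forall a b c : bmon,
    associ c a b ∘ braid (a ⊗ b) c ∘ associ a b c =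
    (braid a c ⊠ idm b) ∘ associ a c b ∘ (idm a ⊠ braid b c)
}.

Arguments braid {_} _ _.
Arguments braidi {_} _ _.

Definition id_of_eq (C : category) (a b : C) (e : a = b) : mor a b :=
  match e in _ = c return mor a c with erefl => idm a end.

(* Strictness: the constraints are identity morphisms, so that their
   occurrences in the definitions below may be ignored when M is strict. *)
Record strict (M : monoidal) : Prop := Strict {
  strict_assoc : forall a b c : M,
    exists e : (a ⊗ b) ⊗ c = a ⊗ (b ⊗ c), assoc a b c = id_of_eq e;
  strict_runit : forall a : M,
    exists e : a ⊗ munit = a, runit a = id_of_eq e;
  strict_lunit : forall a : M,
    exists e : munit ⊗ a = a, lunit a = id_of_eq e
}.

Record left_duality (M : monoidal) := LeftDuality {
  dual : M -> M;
  coev : forall a : M, mor munit (a ⊗ dual a);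
  ev : forall a : M, mor (dual a ⊗ a) munit;
  zigzag : forall a : M,
    runit a ∘ (idm a ⊠ ev a) ∘ assoc a (dual a) a ∘ (coev a ⊠ idm a)
      ∘ luniti a = idm a;
  zigzag_dual : forall a : M,
    lunit (dual a) ∘ (ev a ⊠ idm (dual a)) ∘ associ (dual a) a (dual a)
      ∘ (idm (dual a) ⊠ coev a) ∘ runiti (dual a) = idm (dual a)
}.

(* Z puts an abelian group structure on each hom-set. *)
Definition mor_zmod (C : category) (Z : forall a b : C, GRing.Zmodule (mor a b))
  (a b : C) : zmodType := GRing.Zmodule.Pack (Z a b).

Record ab_structure (C : category) := AbStructure {
  ab_zmod : forall a b : C, GRing.Zmodule (mor a b);
  ab_compmDl : forall (a b c : C) (g g' : mor_zmod ab_zmod b c) (f : mor a b),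
    compm (g + g') f = (compm g f : mor_zmod ab_zmod a c) + compm g' f;
  ab_compmDr : forall (a b c : C) (g : mor b c) (f f' : mor_zmod ab_zmod a b),
    compm g (f + f') = (compm g f : mor_zmod ab_zmod a c) + compm g f'
}.

Record braided_ab := BraidedAb {
  bab :> braided;
  bab_str : ab_structure bab;
  bab_tensmDl : forall (a a' b b' : bab)
      (f f' : mor_zmod (ab_zmod bab_str) a a') (g : mor b b'),
    tensm (f + f') g =
    (tensm f g : mor_zmod (ab_zmod bab_str) (a ⊗ b) (a' ⊗ b')) + tensm f' g;
  bab_tensmDr : forall (a a' b b' : bab)
      (f : mor a a') (g g' : mor_zmod (ab_zmod bab_str) b b'),
    tensm f (g + g') =
    (tensm f g : mor_zmod (ab_zmod bab_str) (a ⊗ b) (a' ⊗ b')) + tensm f g'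
}.

HB.instance Definition _ (C : braided_ab) (a b : C) :=
  GRing.Zmodule.copy (mor a b) (mor_zmod (ab_zmod (bab_str C)) a b).

Section Canonical.
Variable M : monoidal.

(* the class of constraint morphisms entering the relation ≐ *)
Inductive canonical : forall a b : M, mor a b -> Prop :=
| can_id a : canonical (idm a)
| can_assoc a b c : canonical (assoc a b c)
| can_associ a b c : canonical (associ a b c)
| can_runit a : canonical (runit a)
| can_runiti a : canonical (runiti a)
| can_lunit a : canonical (lunit a)
| can_luniti a : canonical (luniti a)
| can_tens a a' b b' (f : mor a a') (g : mor b b') :
    canonical f -> canonical g -> canonical (f ⊠ g)
| can_comp a b c (g : mor b c) (f : mor a b) :
    canonical g -> canonical f -> canonical (g ∘ f).

Definition doteq (a b a' b' : M) (f : mor a b) (g : mor a' b') : Prop :=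
  exists (x : mor b b') (y : mor a' a),
    [/\ canonical x, canonical y & g = x ∘ f ∘ y].

End Canonical.

Notation "f ≐ g" := (doteq f g) (at level 70, no associativity) : moncat_scope.

Record is_algebra (M : monoidal) (H : M)
    (mu : mor (H ⊗ H) H) (eta : mor munit H) : Prop := IsAlgebra {
  algA : mu ∘ (mu ⊠ idm H) ≐ mu ∘ (idm H ⊠ mu);
  alg1l : mu ∘ (eta ⊠ idm H) ≐ idm H;
  alg1r : idm H ≐ mu ∘ (idm H ⊠ eta)
}.

Record is_coalgebra (M : monoidal) (H : M)
    (Delta : mor H (H ⊗ H)) (eps : mor H munit) : Prop := IsCoalgebra {
  coalgA : (Delta ⊠ idm H) ∘ Delta ≐ (idm H ⊠ Delta) ∘ Delta;
  coalg1l : (eps ⊠ idm H) ∘ Delta ≐ idm H;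
  coalg1r : idm H ≐ (idm H ⊠ eps) ∘ Delta
}.

Definition muhat (M : braided) (H : M) (mu : mor (H ⊗ H) H) :
    mor ((H ⊗ H) ⊗ (H ⊗ H)) (H ⊗ H) :=
  (mu ⊠ mu) ∘ assoc (H ⊗ H) H H ∘ (associ H H H ⊠ idm H)
    ∘ ((idm H ⊠ braid H H) ⊠ idm H) ∘ (assoc H H H ⊠ idm H)
    ∘ associ (H ⊗ H) H H.

Record is_bialgebra (M : braided) (H : M)
    (mu : mor (H ⊗ H) H) (eta : mor munit H)
    (Delta : mor H (H ⊗ H)) (eps : mor H munit) : Prop := IsBialgebra {
  bialg_alg : is_algebra mu eta;
  bialg_coalg : is_coalgebra Delta eps;
  bialg_mul : muhat mu ∘ (Delta ⊠ Delta) ≐ Delta ∘ mu;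
  bialg_eps : eps ∘ mu ≐ eps ⊠ eps
}.

Definition is_module (M : monoidal) (H : M)
    (mu : mor (H ⊗ H) H) (eta : mor munit H) (V : M) : Prop :=
  exists T : mor (H ⊗ V) V,
    T ∘ (mu ⊠ idm V) ≐ T ∘ (idm H ⊠ T) /\ T ∘ (eta ⊠ idm V) ≐ idm V.

Record pairing (S0 : Type) := Pairing {
  pair_fun :> S0 * S0 -> S0;
  pair_inv : S0 -> S0 * S0;
  pair_funK : cancel pair_fun pair_inv;
  pair_invK : cancel pair_inv pair_fun
}.

Section Bilinear.
Variable C : braided_ab.

Lemma compmDl (a b c : C) (g g' : mor b c) (f : mor a b) :
  (g + g') ∘ f = g ∘ f + g' ∘ f.
Proof. exact: (@ab_compmDl C (bab_str C)). Qed.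

Lemma compmDr (a b c : C) (g : mor b c) (f f' : mor a b) :
  g ∘ (f + f') = g ∘ f + g ∘ f'.
Proof. exact: (@ab_compmDr C (bab_str C)). Qed.

Lemma tensmDl (a a' b b' : C) (f f' : mor a a') (g : mor b b') :
  (f + f') ⊠ g = f ⊠ g + f' ⊠ g.
Proof. exact: (@bab_tensmDl C). Qed.

Lemma tensmDr (a a' b b' : C) (f : mor a a') (g g' : mor b b') :
  f ⊠ (g + g') = f ⊠ g + f ⊠ g'.
Proof. exact: (@bab_tensmDr C). Qed.

Lemma comp0m (a b c : C) (f : mor a b) : (0 : mor b c) ∘ f = 0.
Proof. by apply: (addrI (0 ∘ f)); rewrite -compmDl !addr0. Qed.

Lemma compm0 (a b c : C) (g : mor b c) : g ∘ (0 : mor a b) = 0.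
Proof. by apply: (addrI (g ∘ 0)); rewrite -compmDr !addr0. Qed.

Lemma tens0m (a a' b b' : C) (g : mor b b') : (0 : mor a a') ⊠ g = 0.
Proof. by apply: (addrI (0 ⊠ g)); rewrite -tensmDl !addr0. Qed.

Lemma tensm0 (a a' b b' : C) (f : mor a a') : f ⊠ (0 : mor b b') = 0.
Proof. by apply: (addrI (f ⊠ 0)); rewrite -tensmDr !addr0. Qed.

Lemma compm_suml (a b c : C) I (r : seq I) (G : I -> mor b c) (f : mor a b) :
  (\sum_(i <- r) G i) ∘ f = \sum_(i <- r) (G i ∘ f).
Proof.
apply: (big_morph (fun g => g ∘ f)) => [g g'|]; first exact: compmDl.
exact: comp0m.
Qed.

Lemma compm_sumr (a b c : C) I (r : seq I) (g : mor b c) (F : I -> mor a b) :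
  g ∘ (\sum_(i <- r) F i) = \sum_(i <- r) (g ∘ F i).
Proof.
apply: (big_morph (fun f => g ∘ f)) => [f f'|]; first exact: compmDr.
exact: compm0.
Qed.

Lemma tensm_suml (a a' b b' : C) I (r : seq I) (F : I -> mor a a')
    (g : mor b b') :
  (\sum_(i <- r) F i) ⊠ g = \sum_(i <- r) (F i ⊠ g).
Proof.
apply: (big_morph (fun f => f ⊠ g)) => [f f'|]; first exact: tensmDl.
exact: tens0m.
Qed.

Lemma tensm_sumr (a a' b b' : C) I (r : seq I) (f : mor a a')
    (G : I -> mor b b') :
  f ⊠ (\sum_(i <- r) G i) = \sum_(i <- r) (f ⊠ G i).
Proof.
apply: (big_morph (fun g => f ⊠ g)) => [g g'|]; first exact: tensmDr.
exact: tensm0.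
Qed.

End Bilinear.

Lemma fsum_seq (T : choiceType) (V : zmodType) (F : T -> V) (r : seq T) :
  uniq r -> (forall t, F t != 0 -> t \in r) ->
  \sum_(t \in [set: T]) F t = \sum_(t <- r) F t.
Proof.
move=> ur cov; rewrite (fsbig_seq _ _ ur) (fsbig_widen [set` r] setT) //.
by move=> t [_ /= tr]; apply: contrapT => /eqP /cov.
Qed.

Section Kron.
Variable C : braided_ab.

(* kron P t t' m is "δ_{t,t'} m", where m : a -> P t. *)
Definition kron (T : Type) (P : T -> C) (a : C) (t t' : T) (m : mor a (P t)) :
    mor a (P t') :=
  match pselect (t = t') with
  | left e => match e in _ = u return mor a (P u) with erefl => m end
  | right _ => 0
  end.

Lemma kronxx (T : Type) (P : T -> C) a t (m : mor a (P t)) : kron t m = m.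
Proof.
rewrite /kron; case: pselect => // e.
by rewrite (Prop_irrelevance e (erefl t)).
Qed.

Lemma kron_neq (T : Type) (P : T -> C) a t t' (m : mor a (P t)) :
  t <> t' -> kron t' m = 0.
Proof. by rewrite /kron; case: pselect. Qed.

Lemma kron_inj (T U : Type) (h : T -> U) (P : U -> C) a t t'
    (m : mor a (P (h t))) :
  injective h -> @kron T (P \o h) a t t' m = @kron U P a (h t) (h t') m.
Proof.
move=> hI; have [e|ne] := pselect (t = t'); first by subst t'; rewrite !kronxx.
by rewrite !kron_neq // => /hI.
Qed.

Lemma kron_tens (T U : Type) (P : T -> C) (Q : U -> C) a b t t' u u'
    (m : mor a (P t)) (n : mor b (Q u)) :
  kron t' m ⊠ kron u' n =
  @kron (T * U) (fun v => P v.1 ⊗ Q v.2) (a ⊗ b) (t, u) (t', u') (m ⊠ n).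
Proof.
have [e|ne] := pselect (t = t'); last first.
  by rewrite (kron_neq _ ne) tens0m kron_neq // => -[].
have [e'|ne] := pselect (u = u'); last first.
  by rewrite (kron_neq _ ne) tensm0 kron_neq // => -[].
by subst t' u'; rewrite !kronxx.
Qed.

Section Sum.
Variables (T : Type) (J : choiceType) (t : J -> T) (t' : T -> J).
Hypotheses (tK : cancel t t') (tK' : cancel t' t).

Lemma sum_kron (P : T -> C) a b u (m : mor a (P u))
    (G : forall v, mor (P v) b) :
  \sum_(z \in [set: J]) (G (t z) ∘ kron (t z) m) = G u ∘ m.
Proof.
rewrite (@fsum_seq _ _ _ [:: t' u]) //.
  by rewrite big_seq1; move: (tK' u) => e; rewrite e kronxx.
move=> z; rewrite inE; apply: contraNT => /eqP zu.
by rewrite kron_neq ?compm0 // => uz; apply: zu; rewrite uz tK.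
Qed.

Lemma sum_kron' (P Q : T -> C) a u (m : forall v, mor (Q v) (P v))
    (F : forall v, mor a (Q v)) :
  \sum_(z \in [set: J]) (kron u (m (t z)) ∘ F (t z)) = m u ∘ F u.
Proof.
rewrite (@fsum_seq _ _ _ [:: t' u]) //.
  by rewrite big_seq1; move: (tK' u) => e; rewrite e kronxx.
move=> z; rewrite inE; apply: contraNT => /eqP zu.
by rewrite kron_neq ?comp0m // => uz; apply: zu; rewrite -uz tK.
Qed.

Lemma sum_kron2 (P Q : T -> C) a u (m : mor a (P u)) u'
    (n : forall v, mor (P v) (Q v)) :
  \sum_(z \in [set: J]) (kron u' (n (t z)) ∘ kron (t z) m) =
  kron u' (n u ∘ m).
Proof.
rewrite (@sum_kron P a _ u m (fun v => kron u' (n v))).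
have [e|ne] := pselect (u = u'); first by subst u'; rewrite !kronxx.
by rewrite !kron_neq // comp0m.
Qed.

End Sum.
End Kron.

(* The category C^{S0}: fobj and fmor are its objects and morphisms. *)
Section Families.
Variables (C : braided_ab) (S0 : choiceType).

Record fobj := Fobj {
  supp : set S0;
  fam :> supp -> C
}.

Definition row_finite (f g : fobj)
    (F : forall (x : supp f) (y : supp g), mor (f x) (g y)) : Prop :=
  infinite_set (supp g) -> forall x : supp f,
    exists2 A : set (supp g), finite_set A & forall y, ~ A y -> F x y = 0.

Record fmor (f g : fobj) := Fmor {
  fmor_fun :> forall (x : supp f) (y : supp g), mor (f x) (g y);
  fmor_fin : row_finite fmor_fun
}.

Lemma fmor_eq (f g : fobj) (F G : fmor f g) :
  (forall x y, F x y = G x y) -> F = G.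
Proof.
case: F G => [F Ff] [G Gf] /= FG.
have e : F = G by apply: functional_extensionality_dep => x;
  apply: functional_extensionality_dep => y; exact: FG.
by subst G; rewrite (Prop_irrelevance Ff Gf).
Qed.

Lemma fmor_cover (f g : fobj) (F : fmor f g) (x : supp f) :
  exists2 r : seq (supp g), uniq r & forall y, F x y != 0 -> y \in r.
Proof.
have [A finA FA] : exists2 A : set (supp g),
    finite_set A & forall y, ~ A y -> F x y = 0.
  have [fin|inf] := pselect (finite_set (supp g)); last exact: (@fmor_fin _ _ F inf x).
  exists setT; last by move=> y /(_ Logic.I).
  have -> : [set: supp g] = (fun y : supp g => val y) @^-1` (supp g).
    by apply/seteqP; split=> // y _ /=; apply: set_mem; exact: valP.
  by apply: finite_preimage => // y z _ _; exact: val_inj.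
have /finite_seqP [r Ar] := finA.
exists (undup r); first exact: undup_uniq.
move=> y Fy; rewrite mem_undup; apply: contrapT => yr.
by move/eqP: Fy; apply; apply: FA; rewrite Ar.
Qed.

Lemma kron_fin (I : choiceType) (T : Type) (P : T -> C) a u (m : mor a (P u))
    (t : I -> T) : injective t ->
  exists2 A : set I, finite_set A & forall y, ~ A y -> kron (t y) m = 0.
Proof.
move=> tI; exists [set y | t y = u]; last first.
  by move=> y /= ty; apply: kron_neq => /esym.
have [[y ty]|no] := pselect (exists y, t y = u).
  apply: (sub_finite_set _ (finite_set1 y)) => z /= tz.
  by apply: tI; rewrite tz.
by apply: (sub_finite_set _ (finite_set0 _)) => z /= tz; apply: no; exists z.
Qed.

Fact idf_fin (f : fobj) :
  @row_finite f f (fun x y => kron y (idm (f x))).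
Proof. by move=> _ x; apply: (@kron_fin _ _ f _ x _ id). Qed.

Definition idf (f : fobj) : fmor f f := Fmor (@idf_fin f).

Fact compf_fin (f g k : fobj) (G : fmor g k) (F : fmor f g) :
  @row_finite f k
    (fun x y => \sum_(z \in [set: supp g]) (G z y ∘ F x z)).
Proof.
move=> inf x; have [r _ rP] := fmor_cover F x.
have Gf z : {A : set (supp k) | finite_set A &
    forall y, ~ A y -> G z y = 0}.
  by apply: cid2; exact: (@fmor_fin _ _ G inf z).
pose A z := let: exist2 B _ _ := Gf z in B.
exists (\bigcup_(z in [set` r]) A z).
  apply: bigcup_finite; first exact: finite_seq.
  by move=> z _; rewrite /A; case: (Gf z).
move=> y yA; apply: fsbig1 => z _.
have [zr|zr] := boolP (z \in r).
  have : ~ A z y by move=> Azy; apply: yA; exists z.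
  by rewrite /A; case: (Gf z) => B _ BP /BP ->; rewrite comp0m.
have [->|/rP] := eqVneq (F x z) 0; first by rewrite compm0.
by move/negP: zr.
Qed.

Definition compf (f g k : fobj) (G : fmor g k) (F : fmor f g) : fmor f k :=
  Fmor (@compf_fin f g k G F).

Lemma compf_seq (f g k : fobj) (G : fmor g k) (F : fmor f g) x y r :
  uniq r -> (forall z, F x z != 0 -> z \in r) ->
  compf G F x y = \sum_(z <- r) (G z y ∘ F x z).
Proof.
move=> ur rP; apply: fsum_seq => // z nz; apply: rP.
by apply: contra_neq nz => ->; rewrite compm0.
Qed.

Fact compfA (f g k l : fobj) (H : fmor k l) (G : fmor g k) (F : fmor f g) :
  compf H (compf G F) = compf (compf H G) F.
Proof.
apply: fmor_eq => x y.
have [r ur rP] := fmor_cover F x.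
have Gc z : {s : seq (supp k) | uniq s & forall y, G z y != 0 -> y \in s}.
  by apply: cid2; exact: fmor_cover.
pose s z := let: exist2 s _ _ := Gc z in s.
pose S := undup (flatten [seq s z | z <- r]).
have uS : uniq S by exact: undup_uniq.
have SP z w : z \in r -> G z w != 0 -> w \in S.
  move=> zr Gzw; rewrite mem_undup; apply/flatten_mapP; exists z => //.
  by move: Gzw; rewrite /s; case: (Gc z) => q _; apply.
rewrite (compf_seq _ _ ur rP) (@compf_seq _ _ _ _ _ _ _ S) //; last first.
  move=> w; rewrite (compf_seq _ _ ur rP); apply: contraNT => wS.
  rewrite big_seq big1 // => z zr.
  have [->|/(SP _ _ zr)] := eqVneq (G z w) 0; first by rewrite comp0m.
  by move/negP: wS.
under eq_bigr do rewrite (compf_seq _ _ ur rP) compm_sumr.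
rewrite exchange_big /= big_seq [RHS]big_seq; apply: eq_bigr => z zr.
rewrite -[X in _ = X ∘ _]/(compf H G z y) (@compf_seq _ _ _ _ _ _ _ S) //.
  by rewrite compm_suml; apply: eq_bigr => w _; rewrite compmA.
by move=> w; exact: SP.
Qed.

Fact comp1f (f g : fobj) (F : fmor f g) : compf (idf g) F = F.
Proof.
apply: fmor_eq => x y /=.
have := @sum_kron' C _ _ (@id (supp g)) id (frefl _) (frefl _) g g _ y
  (fun v => idm (g v)) (F x).
by rewrite comp1m.
Qed.

Fact compf1 (f g : fobj) (F : fmor f g) : compf F (idf f) = F.
Proof.
apply: fmor_eq => x y /=.
have := @sum_kron C _ _ (@id (supp f)) id (frefl _) (frefl _) f _ _ x
  (idm (f x)) (fun v => F v y).
by rewrite compm1.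
Qed.

Definition fobj_category : category := Category compfA comp1f compf1.

End Families.

Section KronComp.
Variables (C : braided_ab) (S0 : choiceType).

Lemma compf_kron (T : Type) (S S' : set S0) (t : S -> T) (t' : T -> S)
    (r : S' -> T) (P Q : T -> C) (f : fobj C S0)
    (F : fmor f (Fobj (P \o t))) (G : fmor (Fobj (P \o t)) (Fobj (Q \o r)))
    (x : supp f) (y : S') (u : T) (m : mor (f x) (P u))
    (n : forall v, mor (P v) (Q v)) :
  cancel t t' -> cancel t' t ->
  (forall z : S, F x z = @kron C T P _ u (t z) m) ->
  (forall z : S, G z y = @kron C T Q _ (t z) (r y) (n (t z))) ->
  compf G F x y = @kron C T Q _ u (r y) (n u ∘ m).
Proof.
move=> tK t'K FE GE /=.
rewrite -(@sum_kron2 C T S t t' tK t'K P Q).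
by apply: eq_fsbigr => z _; rewrite FE GE.
Qed.

End KronComp.

Section Tensor.
Variables (C : braided_ab) (S0 : choiceType) (gamma : pairing S0) (pt : S0).

Implicit Types (A B D E : set S0).
Local Notation fobj := (fobj C S0).
Implicit Types (f g k l : fobj).

Definition tsupp A B : set S0 := gamma @` (A `*` B).

Fact tsuppP A B p :
  tsupp A B p -> A (pair_inv gamma p).1 /\ B (pair_inv gamma p).2.
Proof. by case=> -[x y] /= [Ax By] <-; rewrite pair_funK. Qed.

Definition tpr1 A B (p : tsupp A B) : A :=
  exist _ (pair_inv gamma (val p)).1
    (mem_set (proj1 (tsuppP (set_mem (valP p))))).

Definition tpr2 A B (p : tsupp A B) : B :=
  exist _ (pair_inv gamma (val p)).2
    (mem_set (proj2 (tsuppP (set_mem (valP p))))).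

Fact tpair_mem A B (x : A) (y : B) : gamma (val x, val y) \in tsupp A B.
Proof.
apply: mem_set; exists (val x, val y) => //.
by split; apply: set_mem; exact: valP.
Qed.

Definition tpair A B (x : A) (y : B) : tsupp A B :=
  exist _ (gamma (val x, val y)) (tpair_mem x y).

Lemma tpr1K A B (x : A) (y : B) : tpr1 (tpair x y) = x.
Proof. by apply: val_inj; rewrite /= pair_funK. Qed.

Lemma tpr2K A B (x : A) (y : B) : tpr2 (tpair x y) = y.
Proof. by apply: val_inj; rewrite /= pair_funK. Qed.

Lemma tpairK A B (p : tsupp A B) : tpair (tpr1 p) (tpr2 p) = p.
Proof. by apply: val_inj; rewrite /= -surjective_pairing pair_invK. Qed.

Lemma tpr_inj A B (p q : tsupp A B) :
  tpr1 p = tpr1 q -> tpr2 p = tpr2 q -> p = q.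
Proof. by move=> e1 e2; rewrite -(tpairK p) e1 e2 tpairK. Qed.

Lemma tpr_val_inj A B (p q : tsupp A B) :
  (pair_inv gamma (val p)).1 = (pair_inv gamma (val q)).1 ->
  (pair_inv gamma (val p)).2 = (pair_inv gamma (val q)).2 -> p = q.
Proof. by move=> e1 e2; apply: tpr_inj; apply: val_inj. Qed.

Definition tensf f g : fobj :=
  Fobj (fun p : tsupp (supp f) (supp g) => f (tpr1 p) ⊗ g (tpr2 p)).

Definition unitf : fobj := Fobj (fun _ : [set pt] => munit : C).

Lemma tsupp_cover A B (P1 : A -> Prop) (P2 : B -> Prop) r1 r2 :
  uniq r1 -> uniq r2 -> (forall x, P1 x -> x \in r1) ->
  (forall y, P2 y -> y \in r2) ->
  let r := [seq tpair x y | x <- r1, y <- r2] in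
  uniq r /\ forall p, P1 (tpr1 p) -> P2 (tpr2 p) -> p \in r.
Proof.
move=> u1 u2 c1 c2; split.
  apply: allpairs_uniq => // -[x y] [x' y'] _ _ /= e.
  by congr pair; [rewrite -(tpr1K x y) e tpr1K|rewrite -(tpr2K x y) e tpr2K].
by move=> p /c1 h1 /c2 h2; apply/allpairsP; exists (tpr1 p, tpr2 p);
  rewrite tpairK.
Qed.

Fact tensfm_fin f f' g g' (F : fmor f f') (G : fmor g g') :
  @row_finite C S0 (tensf f g) (tensf f' g')
    (fun p q => F (tpr1 p) (tpr1 q) ⊠ G (tpr2 p) (tpr2 q)).
Proof.
move=> _ p.
have [r1 u1 c1] := fmor_cover F (tpr1 p).
have [r2 u2 c2] := fmor_cover G (tpr2 p).
have [_ c] := tsupp_cover u1 u2 c1 c2.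
exists [set` [seq tpair x y | x <- r1, y <- r2]]; first exact: finite_seq.
move=> q /= nq.
have [->|F0] := eqVneq (F (tpr1 p) (tpr1 q)) 0; first by rewrite tens0m.
have [->|G0] := eqVneq (G (tpr2 p) (tpr2 q)) 0; first by rewrite tensm0.
by case: nq; exact: c.
Qed.

Definition tensfm f f' g g' (F : fmor f f') (G : fmor g g') :
    fmor (tensf f g) (tensf f' g') :=
  Fmor (@tensfm_fin f f' g g' F G).

Section Coordinates.
Variables A B D : set S0.

Definition crdl (p : tsupp (tsupp A B) D) : A * B * D :=
  (tpr1 (tpr1 p), tpr2 (tpr1 p), tpr2 p).
Definition crdl_inv (v : A * B * D) : tsupp (tsupp A B) D :=
  tpair (tpair v.1.1 v.1.2) v.2.
Definition crdr (q : tsupp A (tsupp B D)) : A * B * D :=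
  (tpr1 q, tpr1 (tpr2 q), tpr2 (tpr2 q)).
Definition crdr_inv (v : A * B * D) : tsupp A (tsupp B D) :=
  tpair v.1.1 (tpair v.1.2 v.2).

Lemma crdlK : cancel crdl crdl_inv.
Proof. by move=> p; rewrite /crdl_inv /= !tpairK. Qed.
Lemma crdl_invK : cancel crdl_inv crdl.
Proof. by case=> [[x y] z]; rewrite /crdl !(tpr1K, tpr2K). Qed.
Lemma crdrK : cancel crdr crdr_inv.
Proof. by move=> p; rewrite /crdr_inv /= !tpairK. Qed.
Lemma crdr_invK : cancel crdr_inv crdr.
Proof. by case=> [[x y] z]; rewrite /crdr !(tpr1K, tpr2K). Qed.

Definition swp (q : tsupp B A) : A * B := (tpr2 q, tpr1 q).
Definition swp_inv (v : A * B) : tsupp B A := tpair v.2 v.1.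
Definition tpr (p : tsupp A B) : A * B := (tpr1 p, tpr2 p).
Definition tpr_inv (v : A * B) : tsupp A B := tpair v.1 v.2.

Lemma swpK : cancel swp swp_inv.
Proof. by move=> p; rewrite /swp_inv /= !tpairK. Qed.
Lemma swp_invK : cancel swp_inv swp.
Proof. by case=> [x y]; rewrite /swp !(tpr1K, tpr2K). Qed.
Lemma tprK : cancel tpr tpr_inv.
Proof. by move=> p; rewrite /tpr_inv /= !tpairK. Qed.
Lemma tpr_invK : cancel tpr_inv tpr.
Proof. by case=> [x y]; rewrite /tpr !(tpr1K, tpr2K). Qed.

Definition ptI : [set pt] := exist _ pt (mem_set (erefl pt)).
Lemma ptIE (x : [set pt]) : x = ptI.
Proof. by apply: val_inj; have := set_mem (valP x). Qed.

Definition runit_inv (x : A) : tsupp A [set pt] := tpair x ptI.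
Definition lunit_inv (x : A) : tsupp [set pt] A := tpair ptI x.

Lemma rcrdK : cancel (@tpr1 A [set pt]) runit_inv.
Proof. by move=> p; rewrite /runit_inv -(ptIE (tpr2 p)) tpairK. Qed.
Lemma rcrd_invK : cancel runit_inv (@tpr1 A [set pt]).
Proof. by move=> x; rewrite tpr1K. Qed.
Lemma lcrdK : cancel (@tpr2 [set pt] A) lunit_inv.
Proof. by move=> p; rewrite /lunit_inv -(ptIE (tpr1 p)) tpairK. Qed.
Lemma lcrd_invK : cancel lunit_inv (@tpr2 [set pt] A).
Proof. by move=> x; rewrite tpr2K. Qed.

End Coordinates.

(* The entries of the constraints of C^{S0} are δ times the corresponding
   constraint of C; when C is strict the latter is an identity. *)
Section Constraints.
Variables f g k : fobj.

Fact assocf_fin : @row_finite C S0 (tensf (tensf f g) k) (tensf f (tensf g k))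
  (fun p q => @kron C _ (fun v => f v.1.1 ⊗ (g v.1.2 ⊗ k v.2)) _
    (crdl p) (crdr q) (assoc _ _ _)).
Proof. by move=> _ x; exact: (kron_fin _ (can_inj (@crdrK (supp f) (supp g) (supp k)))). Qed.

Definition assocf : fmor (tensf (tensf f g) k) (tensf f (tensf g k)) :=
  Fmor assocf_fin.

Fact associf_fin : @row_finite C S0 (tensf f (tensf g k)) (tensf (tensf f g) k)
  (fun q p => @kron C _ (fun v => (f v.1.1 ⊗ g v.1.2) ⊗ k v.2) _
    (crdr q) (crdl p) (associ _ _ _)).
Proof. by move=> _ x; exact: (kron_fin _ (can_inj (@crdlK (supp f) (supp g) (supp k)))). Qed.

Definition associf : fmor (tensf f (tensf g k)) (tensf (tensf f g) k) :=
  Fmor associf_fin.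

Fact runitf_fin : @row_finite C S0 (tensf f unitf) f
  (fun p x => @kron C _ f _ (tpr1 p) x (runit _)).
Proof. by move=> _ p; exact: (@kron_fin _ _ _ f _ _ _ id). Qed.

Definition runitf : fmor (tensf f unitf) f := Fmor runitf_fin.

Fact runitif_fin : @row_finite C S0 f (tensf f unitf)
  (fun x p => @kron C _ (fun x => f x ⊗ munit) _ x (tpr1 p) (runiti _)).
Proof. by move=> _ x; exact: (kron_fin _ (can_inj (@rcrdK (supp f)))). Qed.

Definition runitif : fmor f (tensf f unitf) := Fmor runitif_fin.

Fact lunitf_fin : @row_finite C S0 (tensf unitf f) f
  (fun p x => @kron C _ f _ (tpr2 p) x (lunit _)).
Proof. by move=> _ p; exact: (@kron_fin _ _ _ f _ _ _ id). Qed.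

Definition lunitf : fmor (tensf unitf f) f := Fmor lunitf_fin.

Fact lunitif_fin : @row_finite C S0 f (tensf unitf f)
  (fun x p => @kron C _ (fun x => munit ⊗ f x) _ x (tpr2 p) (luniti _)).
Proof. by move=> _ x; exact: (kron_fin _ (can_inj (@lcrdK (supp f)))). Qed.

Definition lunitif : fmor f (tensf unitf f) := Fmor lunitif_fin.

Fact braidf_fin : @row_finite C S0 (tensf f g) (tensf g f)
  (fun p q => @kron C _ (fun v => g v.2 ⊗ f v.1) _
    (tpr p) (swp q) (braid _ _)).
Proof. by move=> _ x; exact: (kron_fin _ (can_inj (@swpK (supp f) (supp g)))). Qed.

Definition braidf : fmor (tensf f g) (tensf g f) := Fmor braidf_fin.

Fact braidif_fin : @row_finite C S0 (tensf g f) (tensf f g)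
  (fun q p => @kron C _ (fun v => f v.1 ⊗ g v.2) _
    (swp q) (tpr p) (braidi _ _)).
Proof. by move=> _ x; exact: (kron_fin _ (can_inj (@tprK (supp f) (supp g)))). Qed.

Definition braidif : fmor (tensf g f) (tensf f g) := Fmor braidif_fin.

End Constraints.

Fact tensfm1 f g : tensfm (idf f) (idf g) = idf (tensf f g).
Proof.
apply: fmor_eq => p q; rewrite /= kron_tens tensm1.
exact/esym/(@kron_inj C _ _ _ (fun v => f v.1 ⊗ g v.2) _ p q (idm _)
  (can_inj (@tprK (supp f) (supp g)))).
Qed.

Fact tensfm_comp f f' f'' g g' g'' (F' : fmor f' f'') (F : fmor f f')
    (G' : fmor g' g'') (G : fmor g g') :
  tensfm (compf F' F) (compf G' G) = compf (tensfm F' G') (tensfm F G).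
Proof.
apply: fmor_eq => p q.
have [r1 u1 c1] := fmor_cover F (tpr1 p).
have [r2 u2 c2] := fmor_cover G (tpr2 p).
have [u c] := tsupp_cover u1 u2 c1 c2.
rewrite (@compf_seq C S0 _ (tensf f' g') _ _ _ _ _ _ u); last first.
  move=> z nz; apply: c; apply: contra_neq nz => /= ->; first exact: tens0m.
  exact: tensm0.
transitivity (compf F' F (tpr1 p) (tpr1 q) ⊠ compf G' G (tpr2 p) (tpr2 q)) => //.
rewrite (compf_seq _ _ u1 c1) (compf_seq _ _ u2 c2).
rewrite big_allpairs_dep tensm_suml; apply: eq_bigr => z _.
rewrite tensm_sumr; apply: eq_bigr => w _.
by rewrite tensm_comp /= tpr1K tpr2K.
Qed.

Fact assocfK f g k : compf (associf f g k) (assocf f g k) = idf _.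
Proof.
apply: fmor_eq => p q.
refine (etrans (@compf_kron C S0 _ _ _ (@crdr (supp f) (supp g) (supp k)) _ (@crdl _ _ _)
  (fun v => f v.1.1 ⊗ (g v.1.2 ⊗ k v.2)) (fun v => f v.1.1 ⊗ g v.1.2 ⊗ k v.2)
  _ (assocf f g k) (associf f g k) p q (crdl p) (assoc _ _ _)
  (fun v => associ _ _ _) (@crdrK _ _ _) (@crdr_invK _ _ _)
  (fun=> erefl) (fun=> erefl)) _).
rewrite assocK.
exact/esym/(@kron_inj C _ _ _ (fun v => f v.1.1 ⊗ g v.1.2 ⊗ k v.2) _ p q
  (idm _) (can_inj (@crdlK _ _ _))).
Qed.

Fact associfK f g k : compf (assocf f g k) (associf f g k) = idf _.
Proof.
apply: fmor_eq => p q.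
refine (etrans (@compf_kron C S0 _ _ _ (@crdl (supp f) (supp g) (supp k)) _ (@crdr _ _ _)
  (fun v => f v.1.1 ⊗ g v.1.2 ⊗ k v.2) (fun v => f v.1.1 ⊗ (g v.1.2 ⊗ k v.2))
  _ (associf f g k) (assocf f g k) p q (crdr p) (associ _ _ _)
  (fun v => assoc _ _ _) (@crdlK _ _ _) (@crdl_invK _ _ _)
  (fun=> erefl) (fun=> erefl)) _).
rewrite associK.
exact/esym/(@kron_inj C _ _ _ (fun v => f v.1.1 ⊗ (g v.1.2 ⊗ k v.2)) _ p q
  (idm _) (can_inj (@crdrK _ _ _))).
Qed.

Fact runitfK f : compf (runitif f) (runitf f) = idf _.
Proof.
case: f => A f0; pose f := Fobj f0.
apply: fmor_eq => p q.
refine (etrans (@compf_kron C S0 _ _ _ id id (@tpr1 _ _) f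
  (fun x => f x ⊗ munit) _ (runitf f) (runitif f) p q (tpr1 p) (runit _)
  (fun v => runiti _) (frefl _) (frefl _) (fun=> erefl) (fun=> erefl)) _).
rewrite runitK.
exact/esym/(@kron_inj C _ _ _ (fun x => f x ⊗ munit) _ p q
  (idm _) (can_inj (@rcrdK _))).
Qed.

Fact runitifK f : compf (runitf f) (runitif f) = idf _.
Proof.
case: f => A f0; pose f := Fobj f0.
apply: fmor_eq => x y.
refine (etrans (@compf_kron C S0 _ _ _ (@tpr1 (supp f) [set pt]) _ id (fun x => f x ⊗ munit) f
  _ (runitif f) (runitf f) x y x (runiti _)
  (fun v => runit _) (@rcrdK _) (@rcrd_invK _) (fun=> erefl) (fun=> erefl)) _).
by rewrite runitiK.
Qed.

Fact lunitfK f : compf (lunitif f) (lunitf f) = idf _.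
Proof.
case: f => A f0; pose f := Fobj f0.
apply: fmor_eq => p q.
refine (etrans (@compf_kron C S0 _ _ _ id id (@tpr2 _ _) f
  (fun x => munit ⊗ f x) _ (lunitf f) (lunitif f) p q (tpr2 p) (lunit _)
  (fun v => luniti _) (frefl _) (frefl _) (fun=> erefl) (fun=> erefl)) _).
rewrite lunitK.
exact/esym/(@kron_inj C _ _ _ (fun x => munit ⊗ f x) _ p q
  (idm _) (can_inj (@lcrdK _))).
Qed.

Fact lunitifK f : compf (lunitf f) (lunitif f) = idf _.
Proof.
case: f => A f0; pose f := Fobj f0.
apply: fmor_eq => x y.
refine (etrans (@compf_kron C S0 _ _ _ (@tpr2 [set pt] (supp f)) _ id (fun x => munit ⊗ f x) f
  _ (lunitif f) (lunitf f) x y x (luniti _)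
  (fun v => lunit _) (@lcrdK _) (@lcrd_invK _) (fun=> erefl) (fun=> erefl)) _).
by rewrite lunitiK.
Qed.

Fact braidfK f g : compf (braidif f g) (braidf f g) = idf _.
Proof.
apply: fmor_eq => p q.
refine (etrans (@compf_kron C S0 _ _ _ (@swp (supp f) (supp g)) _ (@tpr _ _)
  (fun v => g v.2 ⊗ f v.1) (fun v => f v.1 ⊗ g v.2)
  _ (braidf f g) (braidif f g) p q (tpr p) (braid _ _)
  (fun v => braidi _ _) (@swpK _ _) (@swp_invK _ _)
  (fun=> erefl) (fun=> erefl)) _).
rewrite braidK.
exact/esym/(@kron_inj C _ _ _ (fun v => f v.1 ⊗ g v.2) _ p q
  (idm _) (can_inj (@tprK _ _))).
Qed.

Fact braidifK f g : compf (braidf f g) (braidif f g) = idf _.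
Proof.
apply: fmor_eq => p q.
refine (etrans (@compf_kron C S0 _ _ _ (@tpr (supp f) (supp g)) _ (@swp _ _)
  (fun v => f v.1 ⊗ g v.2) (fun v => g v.2 ⊗ f v.1)
  _ (braidif f g) (braidf f g) p q (swp p) (braidi _ _)
  (fun v => braid _ _) (@tprK _ _) (@tpr_invK _ _)
  (fun=> erefl) (fun=> erefl)) _).
rewrite braidiK.
exact/esym/(@kron_inj C _ _ _ (fun v => g v.2 ⊗ f v.1) _ p q
  (idm _) (can_inj (@swpK _ _))).
Qed.

Fact assocf_nat f f' g g' k k' (F : fmor f f') (G : fmor g g')
    (K : fmor k k') :
  compf (assocf f' g' k') (tensfm (tensfm F G) K) =
  compf (tensfm F (tensfm G K)) (assocf f g k).
Proof.
apply: fmor_eq => p q; rewrite /=.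
have := @sum_kron' C _ _ _ _ (@crdlK (supp f') (supp g') (supp k'))
  (@crdl_invK _ _ _) (fun v => f' v.1.1 ⊗ (g' v.1.2 ⊗ k' v.2))
  (fun v => f' v.1.1 ⊗ g' v.1.2 ⊗ k' v.2) _ (crdr q)
  (fun v => assoc _ _ _)
  (fun v => F (tpr1 (tpr1 p)) v.1.1 ⊠ G (tpr2 (tpr1 p)) v.1.2 ⊠ K (tpr2 p) v.2).
move=> ->.
have := @sum_kron C _ _ _ _ (@crdrK (supp f) (supp g) (supp k))
  (@crdr_invK _ _ _) (fun v => f v.1.1 ⊗ (g v.1.2 ⊗ k v.2)) _ _ (crdl p)
  (assoc _ _ _) (fun v => F v.1.1 (tpr1 q) ⊠
     (G v.1.2 (tpr1 (tpr2 q)) ⊠ K v.2 (tpr2 (tpr2 q)))).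
move=> ->.
by rewrite assoc_nat.
Qed.

Fact runitf_nat f f' (F : fmor f f') :
  compf (runitf f') (tensfm F (idf unitf)) = compf F (runitf f).
Proof.
apply: fmor_eq => p q; rewrite /=.
have := @sum_kron C _ _ _ _ (frefl (@id (supp f))) (frefl _) f _ _ (tpr1 p)
  (runit _) (fun v => F v q).
move=> ->.
have := @sum_kron' C _ _ _ _ (@rcrdK (supp f')) (@rcrd_invK _) f'
  (fun v => f' v ⊗ munit) _ q (fun v => runit _)
  (fun v => F (tpr1 p) v ⊠ idm munit).
rewrite runit_nat => <-; apply: eq_fsbigr => z _; congr (_ ∘ (_ ⊠ _)).
by rewrite (ptIE (tpr2 z)) (ptIE (tpr2 p)) kronxx.
Qed.

Fact lunitf_nat f f' (F : fmor f f') :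
  compf (lunitf f') (tensfm (idf unitf) F) = compf F (lunitf f).
Proof.
apply: fmor_eq => p q; rewrite /=.
have := @sum_kron C _ _ _ _ (frefl (@id (supp f))) (frefl _) f _ _ (tpr2 p)
  (lunit _) (fun v => F v q).
move=> ->.
have := @sum_kron' C _ _ _ _ (@lcrdK (supp f')) (@lcrd_invK _) f'
  (fun v => munit ⊗ f' v) _ q (fun v => lunit _)
  (fun v => idm munit ⊠ F (tpr2 p) v).
rewrite lunit_nat => <-; apply: eq_fsbigr => z _; congr (_ ∘ (_ ⊠ _)).
by rewrite (ptIE (tpr1 z)) (ptIE (tpr1 p)) kronxx.
Qed.

Fact braidf_nat f f' g g' (F : fmor f f') (G : fmor g g') :
  compf (braidf f' g') (tensfm F G) = compf (tensfm G F) (braidf f g).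
Proof.
apply: fmor_eq => p q; rewrite /=.
have := @sum_kron' C _ _ _ _ (@tprK (supp f') (supp g')) (@tpr_invK _ _)
  (fun v => g' v.2 ⊗ f' v.1) (fun v => f' v.1 ⊗ g' v.2) _ (swp q)
  (fun v => braid _ _) (fun v => F (tpr1 p) v.1 ⊠ G (tpr2 p) v.2).
move=> ->.
have := @sum_kron C _ _ _ _ (@swpK (supp f) (supp g)) (@swp_invK _ _)
  (fun v => g v.2 ⊗ f v.1) _ _ (tpr p) (braid _ _)
  (fun v => G v.2 (tpr1 q) ⊠ F v.1 (tpr2 q)).
move=> ->.
by rewrite braid_nat.
Qed.

Local Ltac crdK :=
  intros ?; repeat apply: tpr_inj; rewrite /= ?(tpr1K, tpr2K) //.

Fact pentagonf f g k l :
  compf (assocf f g (tensf k l)) (assocf (tensf f g) k l) =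
  compf (compf (tensfm (idf f) (assocf g k l)) (assocf f (tensf g k) l))
    (tensfm (assocf f g k) (idf l)).
Proof.
apply: fmor_eq => p q.
pose T : Type := (supp f * supp g * supp k * supp l)%type.
pose Q (v : T) := f v.1.1.1 ⊗ (g v.1.1.2 ⊗ (k v.1.2 ⊗ l v.2)).
pose ql (w : tsupp (tsupp (tsupp (supp f) (supp g)) (supp k)) (supp l)) : T :=
  (tpr1 (tpr1 (tpr1 w)), tpr2 (tpr1 (tpr1 w)), tpr2 (tpr1 w), tpr2 w).
pose qr (w : tsupp (supp f) (tsupp (supp g) (tsupp (supp k) (supp l)))) : T :=
  (tpr1 w, tpr1 (tpr2 w), tpr1 (tpr2 (tpr2 w)), tpr2 (tpr2 (tpr2 w))).
pose q22 (w : tsupp (tsupp (supp f) (supp g)) (tsupp (supp k) (supp l))) : T :=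
  (tpr1 (tpr1 w), tpr2 (tpr1 w), tpr1 (tpr2 w), tpr2 (tpr2 w)).
pose q13 (w : tsupp (supp f) (tsupp (tsupp (supp g) (supp k)) (supp l))) : T :=
  (tpr1 w, tpr1 (tpr1 (tpr2 w)), tpr2 (tpr1 (tpr2 w)), tpr2 (tpr2 w)).
pose q31 (w : tsupp (tsupp (supp f) (tsupp (supp g) (supp k))) (supp l)) : T :=
  (tpr1 (tpr1 w), tpr1 (tpr2 (tpr1 w)), tpr2 (tpr2 (tpr1 w)), tpr2 w).
transitivity (@kron C T Q _ (ql p) (qr q) (assoc _ _ _ ∘ assoc _ _ _)).
  apply: (@compf_kron C S0 T _ _ q22
    (fun v => tpair (tpair v.1.1.1 v.1.1.2) (tpair v.1.2 v.2)) qr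
    (fun v => (f v.1.1.1 ⊗ g v.1.1.2) ⊗ (k v.1.2 ⊗ l v.2)) Q
    _ (assocf (tensf f g) k l) (assocf f g (tensf k l)) p q (ql p)
    (assoc _ _ _) (fun v => assoc _ _ _)).
  - by crdK.
  - by case=> [[[x y] z] w]; rewrite /q22 /= !(tpr1K, tpr2K).
  - move=> z; apply: (@kron_inj C _ T
      (fun v => (tpr1 v.1.1, tpr2 v.1.1, v.1.2, v.2))
      (fun v => (f v.1.1.1 ⊗ g v.1.1.2) ⊗ (k v.1.2 ⊗ l v.2)) _
      (crdl p) (crdr z)).
    by move=> [[a b] c] [[a' b'] c'] /= [e1 e2 -> ->]; rewrite (tpr_val_inj e1 e2).
  - move=> z; apply: (@kron_inj C _ T
      (fun v => (v.1.1, v.1.2, tpr1 v.2, tpr2 v.2)) Q _ (crdl z) (crdr q)).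
    by move=> [[a b] c] [[a' b'] c'] /= [-> -> e1 e2]; rewrite (tpr_val_inj e1 e2).
rewrite pentagon; symmetry.
apply: (@compf_kron C S0 T _ _ q31
  (fun v => tpair (tpair v.1.1.1 (tpair v.1.1.2 v.1.2)) v.2) qr
  (fun v => (f v.1.1.1 ⊗ (g v.1.1.2 ⊗ k v.1.2)) ⊗ l v.2) Q
  _ (tensfm (assocf f g k) (idf l))
  (compf (tensfm (idf f) (assocf g k l)) (assocf f (tensf g k) l)) p q (ql p)
  (assoc _ _ _ ⊠ idm _)
  (fun v => (idm _ ⊠ assoc _ _ _) ∘ assoc _ (_ ⊗ _) _)).
- by crdK.
- by case=> [[[x y] z] w]; rewrite /q31 /= !(tpr1K, tpr2K).
- move=> z; exact: (@kron_tens C _ _ (fun v => f v.1.1 ⊗ (g v.1.2 ⊗ k v.2))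
    l _ _ (crdl (tpr1 p)) (crdr (tpr1 z)) (tpr2 p) (tpr2 z) (assoc _ _ _)
    (idm _)).
move=> z.
apply: (@compf_kron C S0 T _ _ q13
  (fun v => tpair v.1.1.1 (tpair (tpair v.1.1.2 v.1.2) v.2)) qr
  (fun v => f v.1.1.1 ⊗ ((g v.1.1.2 ⊗ k v.1.2) ⊗ l v.2)) Q
  _ (assocf f (tensf g k) l) (tensfm (idf f) (assocf g k l)) z q (q31 z)
  (assoc _ _ _) (fun v => idm _ ⊠ assoc _ _ _)).
- by crdK.
- by case=> [[[x y] w] s]; rewrite /q13 /= !(tpr1K, tpr2K).
- move=> w; apply: (@kron_inj C _ T
    (fun v => (v.1.1, tpr1 v.1.2, tpr2 v.1.2, v.2))
    (fun v => f v.1.1.1 ⊗ ((g v.1.1.2 ⊗ k v.1.2) ⊗ l v.2)) _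
    (crdl z) (crdr w)).
  by move=> [[a b] c] [[a' b'] c'] /= [-> e1 e2 ->]; rewrite (tpr_val_inj e1 e2).
- move=> w; refine (etrans (@kron_tens C _ _ f
    (fun v => g v.1.1 ⊗ (k v.1.2 ⊗ l v.2)) _ _ (tpr1 w) (tpr1 q)
    (crdl (tpr2 w)) (crdr (tpr2 q)) (idm _) (assoc _ _ _)) _).
  apply: (@kron_inj C _ T (fun v => (v.1, v.2.1.1, v.2.1.2, v.2.2)) Q _ (tpr1 w, crdl (tpr2 w))
    (tpr1 q, crdr (tpr2 q))).
  by move=> [a [[b c] d]] [a' [[b' c'] d']] /= [-> -> -> ->].
Qed.

Fact trianglef f g :
  compf (tensfm (idf f) (lunitf g)) (assocf f unitf g) =
  tensfm (runitf f) (idf g).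
Proof.
apply: fmor_eq => p q; 
transitivity (@kron C _ (fun v => f v.1 ⊗ g v.2) _ (tpr1 (tpr1 p), tpr2 p)
    (tpr q) (runit _ ⊠ idm _)); last first.
  exact/esym/(@kron_tens C _ _ f g _ _ (tpr1 (tpr1 p)) (tpr1 q) (tpr2 p)
    (tpr2 q) (runit _) (idm _)).
rewrite -triangle.
apply: (@compf_kron C S0 (supp f * supp g)%type
  (tsupp (supp f) (tsupp [set pt] (supp g))) _
  (fun w => (tpr1 w, tpr2 (tpr2 w)))
  (fun v => tpair v.1 (tpair ptI v.2)) (@tpr _ _)
  (fun v => f v.1 ⊗ (munit ⊗ g v.2)) (fun v => f v.1 ⊗ g v.2)
  _ (assocf f unitf g) (tensfm (idf f) (lunitf g)) p q
  (tpr1 (tpr1 p), tpr2 p) (assoc _ _ _) (fun v => idm _ ⊠ lunit _)).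
- by move=> w; rewrite /= -(ptIE (tpr1 (tpr2 w))) !tpairK.
- by case=> x y; rewrite /= !(tpr1K, tpr2K).
- move=> z; apply: (@kron_inj C _ _ (fun v => (v.1.1, v.2))
    (fun v => f v.1 ⊗ (munit ⊗ g v.2)) _ (crdl p) (crdr z)).
  by move=> [[a b] c] [[a' b'] c'] /= [-> ->]; rewrite (ptIE b) (ptIE b').
- move=> z; exact: (@kron_tens C _ _ f g _ _ (tpr1 z) (tpr1 q)
    (tpr2 (tpr2 z)) (tpr2 q) (idm _) (lunit _)).
Qed.

Fact hexagonf1 f g k :
  compf (compf (assocf g k f) (braidf f (tensf g k))) (assocf f g k) =
  compf (compf (tensfm (idf g) (braidf f k)) (assocf g f k))
    (tensfm (braidf f g) (idf k)).
Proof.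
apply: fmor_eq => p q.
pose T : Type := (supp f * supp g * supp k)%type.
pose Q (v : T) := g v.1.2 ⊗ (k v.2 ⊗ f v.1.1).
pose t2 (w : tsupp (tsupp (supp g) (supp k)) (supp f)) : T :=
  (tpr2 w, tpr1 (tpr1 w), tpr2 (tpr1 w)).
pose t3 (w : tsupp (supp g) (tsupp (supp k) (supp f))) : T :=
  (tpr2 (tpr2 w), tpr1 w, tpr1 (tpr2 w)).
pose t4 (w : tsupp (tsupp (supp g) (supp f)) (supp k)) : T :=
  (tpr2 (tpr1 w), tpr1 (tpr1 w), tpr2 w).
pose t5 (w : tsupp (supp g) (tsupp (supp f) (supp k))) : T :=
  (tpr1 (tpr2 w), tpr1 w, tpr2 (tpr2 w)).
transitivity (@kron C T Q _ (crdl p) (t3 q)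
    (assoc _ _ _ ∘ braid _ (_ ⊗ _) ∘ assoc _ _ _)).
  apply: (@compf_kron C S0 T _ _ (@crdr _ _ _) (@crdr_inv _ _ _) t3
    (fun v => f v.1.1 ⊗ (g v.1.2 ⊗ k v.2)) Q
    _ (assocf f g k) (compf (assocf g k f) (braidf f (tensf g k))) p q (crdl p)
    (assoc _ _ _) (fun v => assoc _ _ _ ∘ braid _ (_ ⊗ _)) (@crdrK _ _ _)
    (@crdr_invK _ _ _) (fun=> erefl)).
  move=> z; apply: (@compf_kron C S0 T _ _ t2
    (fun v => tpair (tpair v.1.2 v.2) v.1.1) t3
    (fun v => (g v.1.2 ⊗ k v.2) ⊗ f v.1.1) Q
    _ (braidf f (tensf g k)) (assocf g k f) z q (crdr z)
    (braid _ _) (fun v => assoc _ _ _)).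
  - by crdK.
  - by case=> [[x y] w]; rewrite /t2 /= !(tpr1K, tpr2K).
  - move=> w; apply: (@kron_inj C _ T (fun v => (v.1, tpr1 v.2, tpr2 v.2))
      (fun v => (g v.1.2 ⊗ k v.2) ⊗ f v.1.1) _ (tpr z) (swp w)).
    by move=> [a b] [a' b'] /= [-> e1 e2]; rewrite (tpr_val_inj e1 e2).
  - move=> w; apply: (@kron_inj C _ T (fun v => (v.2, v.1.1, v.1.2)) Q _
      (crdl w) (crdr q)).
    by move=> [[a b] c] [[a' b'] c'] /= [-> -> ->].
rewrite hexagon1; symmetry.
apply: (@compf_kron C S0 T _ _ t4 (fun v => tpair (tpair v.1.2 v.1.1) v.2) t3
  (fun v => (g v.1.2 ⊗ f v.1.1) ⊗ k v.2) Q
  _ (tensfm (braidf f g) (idf k))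
  (compf (tensfm (idf g) (braidf f k)) (assocf g f k)) p q (crdl p)
  (braid _ _ ⊠ idm _) (fun v => (idm _ ⊠ braid _ _) ∘ assoc _ _ _)).
- by crdK.
- by case=> [[x y] w]; rewrite /t4 /= !(tpr1K, tpr2K).
- move=> z; exact: (@kron_tens C _ _ (fun v => g v.2 ⊗ f v.1) k _ _
    (tpr (tpr1 p)) (swp (tpr1 z)) (tpr2 p) (tpr2 z) (braid _ _) (idm _)).
move=> z; apply: (@compf_kron C S0 T _ _ t5
  (fun v => tpair v.1.2 (tpair v.1.1 v.2)) t3
  (fun v => g v.1.2 ⊗ (f v.1.1 ⊗ k v.2)) Q
  _ (assocf g f k) (tensfm (idf g) (braidf f k)) z q (t4 z)
  (assoc _ _ _) (fun v => idm _ ⊠ braid _ _)).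
- by crdK.
- by case=> [[x y] w]; rewrite /t5 /= !(tpr1K, tpr2K).
- move=> w; apply: (@kron_inj C _ T (fun v => (v.1.2, v.1.1, v.2))
    (fun v => g v.1.2 ⊗ (f v.1.1 ⊗ k v.2)) _ (crdl z) (crdr w)).
  by move=> [[a b] c] [[a' b'] c'] /= [-> -> ->].
- move=> w; refine (etrans (@kron_tens C _ _ g (fun v => k v.2 ⊗ f v.1) _ _
    (tpr1 w) (tpr1 q) (tpr (tpr2 w)) (swp (tpr2 q)) (idm _) (braid _ _)) _).
  apply: (@kron_inj C _ T (fun v => (v.2.1, v.1, v.2.2)) Q _ (tpr1 w, tpr (tpr2 w))
    (tpr1 q, swp (tpr2 q))).
  by move=> [a [b c]] [a' [b' c']] /= [-> -> ->].
Qed.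

Fact hexagonf2 f g k :
  compf (compf (associf k f g) (braidf (tensf f g) k)) (associf f g k) =
  compf (compf (tensfm (braidf f k) (idf g)) (associf f k g))
    (tensfm (idf f) (braidf g k)).
Proof.
apply: fmor_eq => p q.
pose T : Type := (supp f * supp g * supp k)%type.
pose Q (v : T) := (k v.2 ⊗ f v.1.1) ⊗ g v.1.2.
pose u2 (w : tsupp (supp k) (tsupp (supp f) (supp g))) : T :=
  (tpr1 (tpr2 w), tpr2 (tpr2 w), tpr1 w).
pose u3 (w : tsupp (tsupp (supp k) (supp f)) (supp g)) : T :=
  (tpr2 (tpr1 w), tpr2 w, tpr1 (tpr1 w)).
pose u4 (w : tsupp (supp f) (tsupp (supp k) (supp g))) : T :=
  (tpr1 w, tpr2 (tpr2 w), tpr1 (tpr2 w)).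
pose u5 (w : tsupp (tsupp (supp f) (supp k)) (supp g)) : T :=
  (tpr1 (tpr1 w), tpr2 w, tpr2 (tpr1 w)).
transitivity (@kron C T Q _ (crdr p) (u3 q)
    (associ _ _ _ ∘ braid (_ ⊗ _) _ ∘ associ _ _ _)).
  apply: (@compf_kron C S0 T _ _ (@crdl _ _ _) (@crdl_inv _ _ _) u3
    (fun v => (f v.1.1 ⊗ g v.1.2) ⊗ k v.2) Q
    _ (associf f g k) (compf (associf k f g) (braidf (tensf f g) k)) p q
    (crdr p) (associ _ _ _) (fun v => associ _ _ _ ∘ braid (_ ⊗ _) _)
    (@crdlK _ _ _) (@crdl_invK _ _ _) (fun=> erefl)).
  move=> z; apply: (@compf_kron C S0 T _ _ u2
    (fun v => tpair v.2 (tpair v.1.1 v.1.2)) u3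
    (fun v => k v.2 ⊗ (f v.1.1 ⊗ g v.1.2)) Q
    _ (braidf (tensf f g) k) (associf k f g) z q (crdl z)
    (braid _ _) (fun v => associ _ _ _)).
  - by crdK.
  - by case=> [[x y] w]; rewrite /u2 /= !(tpr1K, tpr2K).
  - move=> w; apply: (@kron_inj C _ T (fun v => (tpr1 v.1, tpr2 v.1, v.2))
      (fun v => k v.2 ⊗ (f v.1.1 ⊗ g v.1.2)) _ (tpr z) (swp w)).
    by move=> [a b] [a' b'] /= [e1 e2 ->]; rewrite (tpr_val_inj e1 e2).
  - move=> w; apply: (@kron_inj C _ T (fun v => (v.1.2, v.2, v.1.1)) Q _
      (crdr w) (crdl q)).
    by move=> [[a b] c] [[a' b'] c'] /= [-> -> ->].
rewrite hexagon2; symmetry.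
apply: (@compf_kron C S0 T _ _ u4 (fun v => tpair v.1.1 (tpair v.2 v.1.2)) u3
  (fun v => f v.1.1 ⊗ (k v.2 ⊗ g v.1.2)) Q
  _ (tensfm (idf f) (braidf g k))
  (compf (tensfm (braidf f k) (idf g)) (associf f k g)) p q (crdr p)
  (idm _ ⊠ braid _ _) (fun v => (braid _ _ ⊠ idm _) ∘ associ _ _ _)).
- by crdK.
- by case=> [[x y] w]; rewrite /u4 /= !(tpr1K, tpr2K).
- move=> w; refine (etrans (@kron_tens C _ _ f (fun v => k v.2 ⊗ g v.1) _ _
    (tpr1 p) (tpr1 w) (tpr (tpr2 p)) (swp (tpr2 w)) (idm _) (braid _ _)) _).
  apply: (@kron_inj C _ T (fun v => (v.1, v.2.1, v.2.2)) (fun v => f v.1.1 ⊗ (k v.2 ⊗ g v.1.2)) _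
    (tpr1 p, tpr (tpr2 p)) (tpr1 w, swp (tpr2 w))).
  by move=> [a [b c]] [a' [b' c']] /= [-> -> ->].
move=> z; apply: (@compf_kron C S0 T _ _ u5
  (fun v => tpair (tpair v.1.1 v.2) v.1.2) u3
  (fun v => (f v.1.1 ⊗ k v.2) ⊗ g v.1.2) Q
  _ (associf f k g) (tensfm (braidf f k) (idf g)) z q (u4 z)
  (associ _ _ _) (fun v => braid _ _ ⊠ idm _)).
- by crdK.
- by case=> [[x y] w]; rewrite /u5 /= !(tpr1K, tpr2K).
- move=> w; apply: (@kron_inj C _ T (fun v => (v.1.1, v.2, v.1.2))
    (fun v => (f v.1.1 ⊗ k v.2) ⊗ g v.1.2) _ (crdr z) (crdl w)).
  by move=> [[a b] c] [[a' b'] c'] /= [-> -> ->].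
- move=> w; refine (etrans (@kron_tens C _ _ (fun v => k v.2 ⊗ f v.1) g _ _
    (tpr (tpr1 w)) (swp (tpr1 q)) (tpr2 w) (tpr2 q) (braid _ _) (idm _)) _).
  apply: (@kron_inj C _ T (fun v => (v.1.1, v.2, v.1.2)) Q _ (tpr (tpr1 w), tpr2 w)
    (swp (tpr1 q), tpr2 q)).
  by move=> [[a b] c] [[a' b'] c'] /= [-> -> ->].
Qed.

Definition fobj_monoidal : monoidal := @Monoidal (fobj_category C S0)
  unitf tensf tensfm assocf associf runitf runitif lunitf lunitif
  tensfm1 tensfm_comp assocfK associfK runitfK runitifK lunitfK lunitifK
  assocf_nat runitf_nat lunitf_nat pentagonf trianglef.

Definition fobj_braided : braided := @Braided fobj_monoidal
  braidf braidif braidfK braidifK braidf_nat hexagonf1 hexagonf2.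

End Tensor.

(* The one-point family at V; xpt V is the chosen point x_V. *)
Definition J (C : braided_ab) (S0 : choiceType) (xpt : C -> S0) (V : C) :
    fobj C S0 :=
  Fobj (fun _ : [set xpt V] => V).

Section Hbar.
Variables (C : braided_ab) (D : left_duality C) (S0 : choiceType).
Variables (gamma : pairing S0) (Sh : set S0) (h : Sh -> C).

Definition diagset (A : set S0) : set (S0 * S0) := [set (x, x) | x in A].

Fact hbar_pointP p : (gamma @` diagset Sh) p -> Sh (pair_inv gamma p).1.
Proof. by case=> _ [x Shx <-] <-; rewrite pair_funK. Qed.

(* the x such that p = gamma (x, x) *)
Definition hbar_point (p : gamma @` diagset Sh) : Sh :=
  exist _ (pair_inv gamma (val p)).1 (mem_set (hbar_pointP (set_mem (valP p)))).

Definition hbar : fobj C S0 :=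
  Fobj (fun p : gamma @` diagset Sh =>
    dual D (h (hbar_point p)) ⊗ h (hbar_point p)).

End Hbar.

(* Main.v *)
Require Import Defs.
From mathcomp Require Import all_boot all_algebra.
From mathcomp Require Import all_classical.

(** Write $a'$ for the left dual of an object [a] of [C], and $d_a$, $b_a$ for
    its evaluation and coevaluation. The family [hbar] is a formal direct sum of
    blocks $a' a$, one for each value [a] of [h] (juxtaposition is the tensor
    product), and its structure is given block by block:
    - the coproduct inserts $b_a$ in the middle, $a' a \to a' (a a') a$, and
      the counit is $d_a$;
    - the product sends the blocks of [a] and [b] to the block of $b a$: the
      strand [a] crosses the whole block $b' b$, which turns $a' a b' b$ into
      $a' b' b a$, and then $a' b'$ is identified with $(b a)'$ by the
      morphism [dualM a b], the transpose of the nested evaluation of [a]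
      and [b]; the unit is $b_I$;
    - a block acts on [v] by $a' a v \to a' v a \to a' a v \to v$, a full twist
      of [a] around [v] followed by $d_a$.

    The axioms for the blocks are isotopies of string diagrams. Where the product
    of the blocks of [a] and [b] occurs, the strands coming from [a] run on one
    side of the strands coming from [b], so the naturality of the braiding
    carries every cup and every cap across the crossings. The other ingredients
    are the hexagon equations, the zigzag equations and the compatibility of
    [dualM] with the cups and caps of $b a$ and with iterated products. The last
    one is checked on mates: a morphism into $v'$ is determined by its mate, its
    composite with $d_v$. The main cases are [mult_assoc], [mult_comult],
    [counit_mult] and [action_mult].

    From the blocks one passes to families as follows. All the structure
    morphisms, and all the constraints of the category of families, are
    [monomial]: their rows have at most one nonzero entry. Monomial morphisms
    are stable under composition and tensor product, and two of them are equal
    when they move the indices in the same way and have the same nonzero entries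
    ([monomial_eq]). The entries agree by the block identities; the indices
    agree because [h] is injective and [C] is strict, so that the operation on
    indices that corresponds to the tensor product is associative and unital.

    Objects such as $(a b) c$ and $a (b c)$, or $h(z)$ and $h(y) h(x)$, are equal
    in these identities without being convertible. Morphisms of [C] are therefore
    compared as [arrow]s, which carry their source and target as data. Composition
    and tensor product are total operations on arrows, the tensor product is
    associative and unital on the nose, and ordinary rewriting applies. *)

Set Implicit Arguments.
Unset Strict Implicit.
Unset Printing Implicit Defensive.

Local Open Scope classical_set_scope.
Local Open Scope moncat_scope.

(** * Morphisms with their source and target as data *)

Section Arrow.
Variable C : braided_ab.

Record arrow := Arr { src : C; tgt : C; amor : mor src tgt }.

(** The zero morphism is the default value for wrong end points; it makes the
    composition below associative without side conditions. *)
Definition hom_of (a b : C) (A : arrow) : mor a b :=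
  match pselect (src A = a /\ tgt A = b) with
  | left (conj ea eb) => id_of_eq eb ∘ amor A ∘ id_of_eq (esym ea)
  | right _ => 0%R
  end.

Definition acomp (g f : arrow) : arrow :=
  Arr (hom_of (tgt f) (tgt g) g ∘ amor f).
Definition atens (f g : arrow) : arrow := Arr (amor f ⊠ amor g).
Definition wire (a : C) : arrow := Arr (idm a).

End Arrow.

Notation "g ⊚ f" := (acomp g f) (at level 45, left associativity) : moncat_scope.
Notation "f ⊙ g" := (atens f g) (at level 38, right associativity) : moncat_scope.

Section StrictCalculus.
Variable C : braided_ab.
Implicit Types (a b c : C) (f g k : arrow C).

Lemma hom_ofK a b (m : mor a b) : hom_of a b (Arr m) = m.
Proof.
rewrite /hom_of; case: pselect => [[ea eb]|[]] //=.
by rewrite (Prop_irrelevance ea erefl) (Prop_irrelevance eb erefl) comp1m compm1.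
Qed.

Lemma hom_of_mismatch a b f : src f <> a -> hom_of a b f = 0%R.
Proof. by move=> ne; rewrite /hom_of; case: pselect => // -[]. Qed.

Lemma Arr_inj a b : injective (@Arr C a b).
Proof. by move=> m n e; rewrite -(hom_ofK m) e hom_ofK. Qed.

Lemma Arr_hom_of a b f : src f = a -> tgt f = b -> Arr (hom_of a b f) = f.
Proof. by case: f => a' b' m /= ea eb; subst a b; rewrite hom_ofK. Qed.

Lemma Arr_id_of_eq a b (e : a = b) : Arr (id_of_eq e) = wire b.
Proof. by subst b. Qed.

Lemma Arr_comp a b c (n : mor b c) (m : mor a b) : Arr (n ∘ m) = Arr n ⊚ Arr m.
Proof. by rewrite /acomp /= hom_ofK. Qed.

Lemma Arr_tens a a' b b' (m : mor a a') (n : mor b b') :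
  Arr (m ⊠ n) = Arr m ⊙ Arr n.
Proof. by []. Qed.

Lemma acompA k g f : k ⊚ (g ⊚ f) = k ⊚ g ⊚ f.
Proof.
case: f g k => [a b f] [b' c g] [c' d k]; rewrite /acomp /=.
have [e|ne] := pselect (b' = b); last first.
  by rewrite !(@hom_of_mismatch b) // comp0m compm0 comp0m.
by subst b'; rewrite !hom_ofK compmA.
Qed.

Lemma wire_acomp b f : tgt f = b -> wire b ⊚ f = f.
Proof. by case: f => a b' m /= <-; rewrite -Arr_comp comp1m. Qed.

Lemma acomp_wire a f : src f = a -> f ⊚ wire a = f.
Proof. by case: f => a' b m /= <-; rewrite -Arr_comp compm1. Qed.

Lemma atens_acomp f' f g' g : src f' = tgt f -> src g' = tgt g ->
  (f' ⊚ f) ⊙ (g' ⊚ g) = (f' ⊙ g') ⊚ (f ⊙ g).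
Proof.
case: f' f g' g => [b c f'] [a b' f] [b1 c1 g'] [a1 b1' g] /= e e1.
by subst b' b1'; rewrite -!Arr_comp /atens /= tensm_comp.
Qed.

Lemma wireM a b : wire (a ⊗ b) = wire a ⊙ wire b.
Proof. by rewrite -Arr_tens tensm1. Qed.

(** * String diagrams in a strict braided category *)

Hypothesis C_strict : strict C.

Lemma tensoA a b c : (a ⊗ b) ⊗ c = a ⊗ (b ⊗ c).
Proof. by have [] := strict_assoc C_strict a b c. Qed.

Lemma tenso1 a : a ⊗ munit = a.
Proof. by have [] := strict_runit C_strict a. Qed.

Lemma tens1o a : munit ⊗ a = a.
Proof. by have [] := strict_lunit C_strict a. Qed.

Lemma Arr_assoc a b c : Arr (assoc a b c) = wire (a ⊗ (b ⊗ c)).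
Proof. by have [e ->] := strict_assoc C_strict a b c; rewrite Arr_id_of_eq. Qed.

Lemma Arr_runit a : Arr (runit a) = wire a.
Proof. by have [e ->] := strict_runit C_strict a; rewrite Arr_id_of_eq. Qed.

Lemma Arr_lunit a : Arr (lunit a) = wire a.
Proof. by have [e ->] := strict_lunit C_strict a; rewrite Arr_id_of_eq. Qed.

Lemma Arr_retract a b (m : mor a b) (n : mor b a) :
  n ∘ m = idm a -> Arr m = wire b -> Arr n = wire a.
Proof.
by move=> nm mb; rewrite -[RHS]/(Arr (idm a)) -nm Arr_comp mb acomp_wire.
Qed.

Lemma Arr_associ a b c : Arr (associ a b c) = wire ((a ⊗ b) ⊗ c).
Proof. exact: (Arr_retract (assocK a b c) (Arr_assoc a b c)). Qed.

Lemma Arr_runiti a : Arr (runiti a) = wire (a ⊗ munit).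
Proof. exact: (Arr_retract (runitK a) (Arr_runit a)). Qed.

Lemma Arr_luniti a : Arr (luniti a) = wire (munit ⊗ a).
Proof. exact: (Arr_retract (lunitK a) (Arr_lunit a)). Qed.

(** The constraints are wires, so their naturality turns into equations between
    tensor products. *)
Lemma atensA f g k : (f ⊙ g) ⊙ k = f ⊙ (g ⊙ k).
Proof.
case: f g k => [a a' f] [b b' g] [c c' k].
have /(congr1 (fun m => Arr m)) := assoc_nat f g k.
by rewrite !Arr_comp !Arr_tens !Arr_assoc wire_acomp ?acomp_wire //= tensoA.
Qed.

Lemma atens1 f : f ⊙ wire munit = f.
Proof.
case: f => a a' f; have /(congr1 (fun m => Arr m)) := runit_nat f.
by rewrite !Arr_comp !Arr_tens !Arr_runit wire_acomp ?acomp_wire //= tenso1.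
Qed.

Lemma wire1_atens f : wire munit ⊙ f = f.
Proof.
case: f => a a' f; have /(congr1 (fun m => Arr m)) := lunit_nat f.
by rewrite !Arr_comp !Arr_tens !Arr_lunit wire_acomp ?acomp_wire //= tens1o.
Qed.

Lemma wire_atens_comp a g f : src g = tgt f ->
  wire a ⊙ (g ⊚ f) = (wire a ⊙ g) ⊚ (wire a ⊙ f).
Proof. by move=> e; rewrite -atens_acomp // acomp_wire. Qed.

Lemma comp_atens_wire a g f : src g = tgt f ->
  (g ⊚ f) ⊙ wire a = (g ⊙ wire a) ⊚ (f ⊙ wire a).
Proof. by move=> e; rewrite -atens_acomp // acomp_wire. Qed.

(** Two arrows drawn side by side can be applied in either order. The variants
    that follow cover an arrow whose source or target is the unit object, where
    the accompanying wire disappears. *)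
Lemma slide_right f g a d : src f = a -> tgt g = d ->
  (f ⊙ wire d) ⊚ (wire a ⊙ g) = f ⊙ g.
Proof. by move=> <- <-; rewrite -atens_acomp // acomp_wire // wire_acomp. Qed.

Lemma slide_left f g b c : tgt f = b -> src g = c ->
  (wire b ⊙ g) ⊚ (f ⊙ wire c) = f ⊙ g.
Proof. by move=> <- <-; rewrite -atens_acomp // acomp_wire // wire_acomp. Qed.

Lemma slide_tgt1_left f g c : tgt f = munit -> src g = c ->
  g ⊚ (f ⊙ wire c) = f ⊙ g.
Proof. by move=> tf sg; rewrite -{1}[g]wire1_atens slide_left. Qed.

Lemma slide_tgt1_right f g a : src f = a -> tgt g = munit ->
  f ⊚ (wire a ⊙ g) = f ⊙ g.
Proof. by move=> sf tg; rewrite -{1}[f]atens1 slide_right. Qed.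

Lemma slide_src1_right f g d : src f = munit -> tgt g = d ->
  (f ⊙ wire d) ⊚ g = f ⊙ g.
Proof. by move=> sf tg; rewrite -{1}[g]wire1_atens slide_right. Qed.

Lemma slide_src1_left f g b : tgt f = b -> src g = munit ->
  (wire b ⊙ g) ⊚ f = f ⊙ g.
Proof. by move=> tf sg; rewrite -{1}[f]atens1 slide_left. Qed.

Lemma comp_through_unit f g : src f = munit -> tgt g = munit -> f ⊚ g = f ⊙ g.
Proof. by move=> sf tg; rewrite -{1}[f]atens1 slide_src1_right. Qed.

(* closes the comparisons of end points left by the rewriting lemmas *)
Local Ltac obj := by rewrite /= ?(tensoA, tenso1, tens1o).

Definition cross a b : arrow C := Arr (braid a b).

Lemma cross_natl f a a' b : src f = a -> tgt f = a' ->
  cross a' b ⊚ (f ⊙ wire b) = (wire b ⊙ f) ⊚ cross a b.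
Proof. by case: f => x y f /= <- <-; rewrite -Arr_tens -!Arr_comp braid_nat. Qed.

Lemma cross_natr f a b b' : src f = b -> tgt f = b' ->
  cross a b' ⊚ (wire a ⊙ f) = (f ⊙ wire a) ⊚ cross a b.
Proof. by case: f => x y f /= <- <-; rewrite -Arr_tens -!Arr_comp braid_nat. Qed.

Lemma crossMr a b c :
  cross a (b ⊗ c) = (wire b ⊙ cross a c) ⊚ (cross a b ⊙ wire c).
Proof.
have /(congr1 (fun m => Arr m)) := hexagon1 a b c.
by rewrite !Arr_comp !Arr_tens !Arr_assoc wire_acomp ?acomp_wire //; obj.
Qed.

Lemma crossMl a b c :
  cross (a ⊗ b) c = (cross a c ⊙ wire b) ⊚ (wire a ⊙ cross b c).
Proof.
have /(congr1 (fun m => Arr m)) := hexagon2 a b c.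
by rewrite !Arr_comp !Arr_tens !Arr_associ wire_acomp ?acomp_wire //; obj.
Qed.

(** Moving [b] across [w] and then [a] across everything, or [a] first: both
    orders give the same braid. This is the part of the associativity of the
    product that concerns the braiding. *)
Lemma cross_exchange a b d w :
  (wire d ⊙ cross (b ⊗ a) w) ⊚ (cross a (d ⊗ b) ⊙ wire w) =
  cross a (d ⊗ (w ⊗ b)) ⊚ (wire (a ⊗ d) ⊙ cross b w).
Proof.
rewrite (wireM a) atensA (@cross_natr _ a (d ⊗ (b ⊗ w))) //.
rewrite -tensoA (crossMr a (d ⊗ b)) crossMl wire_atens_comp; last by obj.
by rewrite wireM !atensA !acompA.
Qed.

(** Used for the crossing with the unit object, which is idempotent by the
    hexagon and invertible, hence a wire. *)
Lemma arrow_idem_wire f g a : src f = a -> tgt f = a ->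
  f ⊚ f = f -> g ⊚ f = wire a -> f = wire a.
Proof.
by move=> sf tf ff gf; rewrite -[LHS](@wire_acomp a) // -gf -acompA ff.
Qed.

Lemma cross1r a : cross a munit = wire a.
Proof.
have gf : Arr (braidi a munit) ⊚ cross a munit = wire a.
  by rewrite -Arr_comp braidK /= -/(wire _) tenso1.
apply: (arrow_idem_wire _ _ _ gf); try obj.
have := crossMr a munit munit.
by rewrite tens1o wire1_atens atens1 => <-.
Qed.

Lemma cross1l a : cross munit a = wire a.
Proof.
have gf : Arr (braidi munit a) ⊚ cross munit a = wire a.
  by rewrite -Arr_comp braidK /= -/(wire _) tens1o.
apply: (arrow_idem_wire _ _ _ gf); try obj.
have := crossMl munit munit a.
by rewrite tens1o wire1_atens atens1 => <-.
Qed.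

(** * Mates, and the dual of a tensor product *)

Variable D : left_duality C.
Local Notation "a ^*" := (dual D a) : moncat_scope.

Definition cap a : arrow C := Arr (ev D a).
Definition cup a : arrow C := Arr (coev D a).

Lemma zigzag_cup_cap a : (wire a ⊙ cap a) ⊚ (cup a ⊙ wire a) = wire a.
Proof.
have /(congr1 (fun m => Arr m)) := zigzag D a.
rewrite !Arr_comp !Arr_tens Arr_assoc Arr_runit Arr_luniti.
rewrite -!acompA wire_acomp ?[wire _ ⊚ (_ ⊚ wire (_ ⊗ _))]wire_acomp;
  try obj.
by rewrite acomp_wire //; obj.
Qed.

Lemma zigzag_cap_cup a : (cap a ⊙ wire a^*) ⊚ (wire a^* ⊙ cup a) = wire a^*.
Proof.
have /(congr1 (fun m => Arr m)) := zigzag_dual D a.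
rewrite !Arr_comp !Arr_tens Arr_associ Arr_lunit Arr_runiti.
rewrite -!acompA wire_acomp ?[wire _ ⊚ (_ ⊚ wire (_ ⊗ _))]wire_acomp;
  try obj.
by rewrite acomp_wire //; obj.
Qed.

Lemma cap_cup1 : cap munit ⊚ cup munit = wire munit.
Proof. by rewrite -zigzag_cup_cap wire1_atens atens1. Qed.

Section Mates.
Variables (u v : C).

(** The arrow from [u] to $v'$ whose mate is [e], from $u v$ to the unit. *)
Definition transpose (e : arrow C) : arrow C :=
  (e ⊙ wire v^*) ⊚ (wire u ⊙ cup v).

Lemma cap_transpose e : src e = u ⊗ v -> tgt e = munit ->
  cap v ⊚ (transpose e ⊙ wire v) = e.
Proof.
move=> se te; rewrite /transpose comp_atens_wire; last by rewrite /= se; obj.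
rewrite !atensA acompA -wireM slide_tgt1_left //.
rewrite -(@slide_tgt1_right e _ (u ⊗ v)) // wireM atensA.
rewrite -acompA -wire_atens_comp; last by obj.
by rewrite zigzag_cup_cap -wireM acomp_wire.
Qed.

Lemma transpose_cap f : src f = u -> tgt f = v^* ->
  transpose (cap v ⊚ (f ⊙ wire v)) = f.
Proof.
move=> sf tf; rewrite /transpose comp_atens_wire; last by rewrite /= tf.
rewrite atensA -wireM -acompA slide_right //.
rewrite -(@slide_left f (cup v) v^* munit) // acompA.
by rewrite zigzag_cap_cup wire_acomp ?atens1.
Qed.

(** Equations between arrows into a dual are proved on their mates, where [dualM]
    turns into evaluations. *)
Lemma mate_inj f g : src f = u -> tgt f = v^* -> src g = u -> tgt g = v^* ->
  cap v ⊚ (f ⊙ wire v) = cap v ⊚ (g ⊙ wire v) -> f = g.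
Proof.
by move=> sf tf sg tg e; rewrite -[LHS]transpose_cap // e transpose_cap.
Qed.

(** If [k] and [e] satisfy the zigzag equation of a duality between [u] and [v],
    then transposing [e] identifies [k] with the coevaluation of [v]. *)
Lemma transpose_cup e k : src e = u ⊗ v -> tgt e = munit ->
  src k = munit -> tgt k = v ⊗ u ->
  (wire v ⊙ e) ⊚ (k ⊙ wire v) = wire v ->
  (wire v ⊙ transpose e) ⊚ k = cup v.
Proof.
move=> se te sk tk ek.
rewrite /transpose wire_atens_comp; last by rewrite /= se; obj.
rewrite -!atensA -wireM -acompA slide_src1_left //.
rewrite -(@slide_right k (cup v) munit (v ⊗ v^*)) // wireM.
rewrite acompA -atensA -comp_atens_wire; last by rewrite /= se tk; obj.
by rewrite ek wire1_atens -wireM wire_acomp.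
Qed.

End Mates.

(** The evaluation and the coevaluation that make $a' b'$ a left dual of
    $b a$. *)
Definition nested_cap a b : arrow C := cap a ⊚ (wire a^* ⊙ cap b ⊙ wire a).
Definition nested_cup a b : arrow C := (wire b ⊙ cup a ⊙ wire b^*) ⊚ cup b.

Lemma zigzag_nested a b :
  (wire (b ⊗ a) ⊙ nested_cap a b) ⊚ (nested_cup a b ⊙ wire (b ⊗ a)) =
  wire (b ⊗ a).
Proof.
rewrite /nested_cap /nested_cup wire_atens_comp; last by obj.
rewrite comp_atens_wire; last by obj.
rewrite !wireM !atensA !acompA.
(* the cap of b and the cup of a are far apart, and trade places *)
have mid : (wire b ⊙ wire a ⊙ wire a^* ⊙ cap b ⊙ wire a) ⊚
    (wire b ⊙ cup a ⊙ wire b^* ⊙ wire b ⊙ wire a) =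
    (wire b ⊙ cup a ⊙ wire a) ⊚ (wire b ⊙ cap b ⊙ wire a).
  rewrite -!wire_atens_comp; try obj.
  rewrite -!atensA -!comp_atens_wire; try obj.
  rewrite !atensA -(atensA (wire a) (wire a^*)) -!wireM.
  by rewrite slide_left // comp_through_unit.
rewrite -(acompA _ _ (wire b ⊙ cup a ⊙ _)) mid acompA.
rewrite -wire_atens_comp; last by obj.
rewrite zigzag_cup_cap -!atensA -wireM -acompA -comp_atens_wire; last by obj.
by rewrite zigzag_cup_cap -wireM wire_acomp // wireM.
Qed.

(** The comparison of the two left duals of $b a$. It is locked because it is a
    composite, which rewriting with the lemmas on composites would otherwise
    unfold. *)
Definition dualM a b : arrow C :=
  locked (transpose (a^* ⊗ b^*) (b ⊗ a) (nested_cap a b)).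

Lemma src_dualM a b : src (dualM a b) = a^* ⊗ b^*.
Proof. by rewrite /dualM -lock; obj. Qed.

Lemma tgt_dualM a b : tgt (dualM a b) = (b ⊗ a)^*.
Proof. by rewrite /dualM -lock; obj. Qed.

Lemma cap_dualM a b :
  cap (b ⊗ a) ⊚ (dualM a b ⊙ wire (b ⊗ a)) = nested_cap a b.
Proof. by rewrite /dualM -lock; apply: cap_transpose => //; obj. Qed.

Lemma dualM_nested_cup a b :
  (wire (b ⊗ a) ⊙ dualM a b) ⊚ nested_cup a b = cup (b ⊗ a).
Proof.
rewrite /dualM -lock; apply: transpose_cup => //; try obj.
exact: zigzag_nested.
Qed.

Local Ltac obj ::=
  by rewrite /= ?(src_dualM, tgt_dualM, tensoA, tenso1, tens1o).

(** Both sides have the threefold nested evaluation of [a], [b] and [c] as their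
    mate. *)
Lemma dualM_assoc a b c :
  dualM (b ⊗ a) c ⊚ (dualM a b ⊙ wire c^*) =
  dualM a (c ⊗ b) ⊚ (wire a^* ⊙ dualM b c).
Proof.
apply: (@mate_inj (a^* ⊗ (b^* ⊗ c^*)) (c ⊗ (b ⊗ a))); try obj.
rewrite !comp_atens_wire; try obj.
rewrite !acompA cap_dualM -tensoA cap_dualM.
transitivity (nested_cap a b ⊚ (wire (a^* ⊗ b^*) ⊙ cap c ⊙ wire (b ⊗ a))).
  rewrite -[nested_cap a b]cap_dualM /nested_cap -!acompA; congr (_ ⊚ _).
  rewrite tensoA (wireM c) !atensA.
  rewrite -!(atensA (wire c^*)) -!wireM.
  by rewrite slide_left ?slide_right //; obj.
rewrite /nested_cap -!acompA; congr (_ ⊚ _).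
rewrite [in RHS]wireM -!atensA -comp_atens_wire; last by obj.
rewrite !atensA -wire_atens_comp; last by obj.
rewrite cap_dualM /nested_cap wire_atens_comp ?comp_atens_wire; try obj.
by rewrite !wireM !atensA.
Qed.

(** The coevaluation of the unit object is an arrow from the unit to its dual, as
    tensoring with the unit changes nothing; the evaluation undoes it. *)
Lemma dualM_unit_left b : dualM munit b ⊚ (cup munit ⊙ wire b^*) = wire b^*.
Proof.
apply: (@mate_inj b^* b); try obj.
rewrite comp_atens_wire; last by obj.
rewrite acompA -{1 3}(tenso1 b) cap_dualM /nested_cap atens1 -acompA.
rewrite atensA -!wireM slide_left; try obj.
rewrite -[cup munit ⊙ _]comp_through_unit // acompA cap_cup1.
by rewrite wire_acomp ?acomp_wire.
Qed.

Lemma dualM_unit_right a : dualM a munit ⊚ (wire a^* ⊙ cup munit) = wire a^*.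
Proof.
apply: (@mate_inj a^* a); try obj.
rewrite comp_atens_wire; last by obj.
rewrite acompA -{1 3}(tens1o a) cap_dualM /nested_cap -acompA.
rewrite atensA -wire_atens_comp; last by obj.
rewrite -comp_atens_wire; last by obj.
by rewrite cap_cup1 wire1_atens.
Qed.

(** * The structure on the blocks *)

Definition block_mult a b : arrow C :=
  (dualM a b ⊙ wire (b ⊗ a)) ⊚ (wire a^* ⊙ cross a (b^* ⊗ b)).
Definition block_comult a : arrow C := wire a^* ⊙ cup a ⊙ wire a.
Definition block_action a v : arrow C :=
  (cap a ⊙ wire v) ⊚ (wire a^* ⊙ (cross v a ⊚ cross a v)).

(** Both products move [a] across the blocks of [b] and [c] and move [b] across
    the block of [c]. Bringing every occurrence of [dualM] to the end leaves
    [dualM_assoc] for the duals and [cross_exchange] for the crossings. *)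
Lemma mult_assoc a b c :
  block_mult (b ⊗ a) c ⊚ (block_mult a b ⊙ wire (c^* ⊗ c)) =
  block_mult a (c ⊗ b) ⊚ (wire (a^* ⊗ a) ⊙ block_mult b c).
Proof.
rewrite /block_mult.
transitivity ((dualM (b ⊗ a) c ⊚ (dualM a b ⊙ wire c^*)) ⊙
    wire (c ⊗ (b ⊗ a)) ⊚
  (wire (a^* ⊗ b^*) ⊙ cross (b ⊗ a) (c^* ⊗ c)) ⊚
  (wire a^* ⊙ cross a (b^* ⊗ b) ⊙ wire (c^* ⊗ c))).
  rewrite !comp_atens_wire; try obj.
  rewrite !acompA; congr (_ ⊚ _); first last.
    by rewrite atensA.
  rewrite -!acompA !atensA -!wireM; congr (_ ⊚ _).
  by rewrite slide_left ?slide_right //; obj.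
rewrite dualM_assoc.
transitivity ((dualM a (c ⊗ b) ⊚ (wire a^* ⊙ dualM b c)) ⊙
    wire (c ⊗ (b ⊗ a)) ⊚
  (wire a^* ⊙ cross a (b^* ⊗ (c^* ⊗ (c ⊗ b)))) ⊚
  (wire (a^* ⊗ (a ⊗ b^*)) ⊙ cross b (c^* ⊗ c))).
  rewrite -!acompA; congr (_ ⊚ _).
  rewrite !(wireM a^*) !atensA -!wire_atens_comp; try obj.
  by rewrite -(tensoA c^*) cross_exchange.
rewrite !comp_atens_wire ?wire_atens_comp; try obj.
rewrite !acompA; congr (_ ⊚ _); first last.
  by rewrite !wireM !atensA.
rewrite -!acompA tensoA; congr (_ ⊚ _).
rewrite !(wireM a^*) !atensA -!wire_atens_comp; try obj.
congr (_ ⊙ _); rewrite (@cross_natr _ a (b^* ⊗ (c^* ⊗ (c ⊗ b)))); try obj.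
by rewrite atensA -wireM tensoA.
Qed.

Lemma mult_unit_left b :
  block_mult munit b ⊚ (cup munit ⊙ wire (b^* ⊗ b)) = wire (b^* ⊗ b).
Proof.
rewrite /block_mult cross1l -[wire munit^* ⊙ _]wireM acomp_wire; last by obj.
rewrite tenso1 wireM -!atensA -comp_atens_wire; last by obj.
by rewrite dualM_unit_left.
Qed.

Lemma mult_unit_right a :
  block_mult a munit ⊚ (wire (a^* ⊗ a) ⊙ cup munit) = wire (a^* ⊗ a).
Proof.
rewrite /block_mult tens1o tenso1 wireM atensA -acompA.
rewrite -wire_atens_comp; last by obj.
rewrite (@cross_natr _ _ munit); try obj.
rewrite cross1r acomp_wire; last by obj.
rewrite -atensA -comp_atens_wire; last by obj.
by rewrite dualM_unit_right.
Qed.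

Lemma comult_coassoc a :
  (block_comult a ⊙ wire (a^* ⊗ a)) ⊚ block_comult a =
  (wire (a^* ⊗ a) ⊙ block_comult a) ⊚ block_comult a.
Proof.
rewrite /block_comult !wireM !atensA -!wire_atens_comp; try obj.
congr (_ ⊙ _); transitivity ((cup a ⊙ cup a) ⊙ wire a).
  rewrite -(@slide_src1_right (cup a) (cup a) (a ⊗ a^*)) //.
  rewrite comp_atens_wire; last by obj.
  by rewrite wireM !atensA.
rewrite -(@slide_src1_left (cup a) (cup a) (a ⊗ a^*)) //.
rewrite comp_atens_wire; last by obj.
by rewrite wireM !atensA.
Qed.

Lemma counit_left a :
  (cap a ⊙ wire (a^* ⊗ a)) ⊚ block_comult a = wire (a^* ⊗ a).
Proof.
rewrite /block_comult !wireM -!atensA -comp_atens_wire; last by obj.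
by rewrite zigzag_cap_cup.
Qed.

Lemma counit_right a :
  (wire (a^* ⊗ a) ⊙ cap a) ⊚ block_comult a = wire (a^* ⊗ a).
Proof.
rewrite /block_comult !wireM !atensA -wire_atens_comp; last by obj.
by rewrite zigzag_cup_cap.
Qed.

(** The nested evaluation closes off [b] first, and the cap of [b] can be pulled
    back through the crossing with [a]. *)
Lemma counit_mult a b : cap (b ⊗ a) ⊚ block_mult a b = cap a ⊙ cap b.
Proof.
rewrite /block_mult acompA cap_dualM /nested_cap -acompA.
rewrite -wire_atens_comp; last by obj.
rewrite -(@cross_natr (cap b) a _ munit) // cross1r wire_acomp; last by obj.
by rewrite -atensA -wireM slide_tgt1_right.
Qed.

(** The braiding part of [mult_comult], for [w] the block of [b] and [f] its
    coproduct. On the left, [a] and the new pair $a a'$ cross the first copy of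
    [w], and [a] alone crosses the second. The cup of [a] passes through its
    crossing, after which [a] crosses both copies of [w], hence [f] too. *)
Lemma cross_twice_comult a w f : src f = w -> tgt f = w ⊗ w ->
  (cross a w ⊙ wire a^* ⊙ cross a w) ⊚
    (wire a ⊙ cross (a^* ⊗ a) w ⊙ wire w) ⊚ (cup a ⊙ wire a ⊙ f) =
  (wire w ⊙ cup a ⊙ wire (w ⊗ a)) ⊚ (f ⊙ wire a) ⊚ cross a w.
Proof.
move=> sf tf.
have -> : cross a w ⊙ wire a^* ⊙ cross a w =
    (wire (w ⊗ (a ⊗ a^*)) ⊙ cross a w) ⊚
    ((cross a w ⊙ wire (a^* ⊗ a)) ⊙ wire w).
  rewrite -atensA -(@slide_left (cross a w ⊙ wire a^*) (cross a w)
    (w ⊗ (a ⊗ a^*)) (a ⊗ w)) //; try obj.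
  by rewrite !wireM !atensA.
rewrite -(atensA (wire a)) -[_ ⊚ _ ⊚ (_ ⊙ wire w)]acompA.
rewrite -comp_atens_wire; last by obj.
(* the strands a a' a now cross w together, and the cup slides through *)
rewrite -crossMl -(atensA (cup a)).
rewrite -(@slide_right (cup a ⊙ wire a) f a (w ⊗ w)) //; try obj.
rewrite (wireM w w) -(atensA _ (wire w)) acompA.
rewrite -[_ ⊚ _ ⊚ (_ ⊙ wire w)]acompA -comp_atens_wire; last by obj.
rewrite (@cross_natl _ a) //; try obj.
rewrite comp_atens_wire; last by obj.
rewrite acompA.
have -> : (wire (w ⊗ (a ⊗ a^*)) ⊙ cross a w) ⊚
    ((wire w ⊙ cup a ⊙ wire a) ⊙ wire w) =
    (wire w ⊙ cup a ⊙ wire (w ⊗ a)) ⊚ (wire w ⊙ cross a w).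
  rewrite wireM !atensA -!wire_atens_comp; try obj.
  by rewrite -wireM slide_left ?slide_src1_right.
rewrite -[_ ⊚ _ ⊚ (cross a w ⊙ _)]acompA -crossMr -acompA.
by rewrite (@cross_natr _ _ w) // acompA.
Qed.

(** After [cross_twice_comult] both sides differ only in how the middle pair is
    created: as a cup of [a] inside a cup of [b], followed by [dualM], or as the
    cup of $b a$. These agree by [dualM_nested_cup]. *)
Lemma mult_comult a b :
  (block_mult a b ⊙ block_mult a b) ⊚
    (wire (a^* ⊗ a) ⊙ cross (a^* ⊗ a) (b^* ⊗ b) ⊙ wire (b^* ⊗ b)) ⊚
    (block_comult a ⊙ block_comult b) =
  block_comult (b ⊗ a) ⊚ block_mult a b.
Proof.
set w := b^* ⊗ b; set v := b ⊗ a.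
transitivity (((dualM a b ⊙ wire v) ⊙ dualM a b ⊙ wire v) ⊚
    (wire a^* ⊙ ((wire w ⊙ cup a ⊙ wire (w ⊗ a)) ⊚
      (block_comult b ⊙ wire a) ⊚ cross a w))).
  rewrite {1 2}/block_mult atens_acomp; try obj.
  rewrite -(@cross_twice_comult a w (block_comult b)) //; try obj.
  rewrite -!acompA; congr (_ ⊚ _).
  by rewrite (wireM a^* a) /block_comult !atensA -!wire_atens_comp //; obj.
have split_cup : dualM a b ⊙ cup v ⊙ wire v =
    ((dualM a b ⊙ wire v) ⊙ dualM a b ⊙ wire v) ⊚
    (wire (a^* ⊗ b^*) ⊙ nested_cup a b ⊙ wire v).
  rewrite (atensA (dualM a b) (wire v)) -(atensA (wire v) (dualM a b)).
  rewrite -atens_acomp; try obj.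
  rewrite -comp_atens_wire; last by obj.
  by rewrite dualM_nested_cup acomp_wire //; obj.
rewrite /block_mult acompA {2}/block_comult.
rewrite (@slide_left (dualM a b) (cup v ⊙ wire v) v^* v) //; try obj.
rewrite split_cup -!acompA; congr (_ ⊚ _).
rewrite (wireM a^* b^*) atensA -!wire_atens_comp; try obj.
congr (_ ⊙ _); rewrite acompA; congr (_ ⊚ _).
rewrite /nested_cup comp_atens_wire; last by obj.
rewrite wire_atens_comp; last by obj.
by rewrite /block_comult !wireM !atensA.
Qed.

Lemma action_unit v : block_action munit v ⊚ (cup munit ⊙ wire v) = wire v.
Proof.
rewrite /block_action cross1l cross1r [wire v ⊚ _]wire_acomp // -wireM.
rewrite acomp_wire; last by obj.
rewrite -comp_atens_wire; last by obj.
by rewrite cap_cup1 wire1_atens.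
Qed.

(** The twist of $b a$ around [v] is the twist of [b], conjugated by the crossings
    of [a] with [v]. Together with the crossing in the product, [a] crosses
    $b' b v$, so it may instead cross [v] after [b] has acted. *)
Lemma action_mult a b v :
  block_action (b ⊗ a) v ⊚ (block_mult a b ⊙ wire v) =
  block_action a v ⊚ (wire (a^* ⊗ a) ⊙ block_action b v).
Proof.
set w := b^* ⊗ b.
(* dualM turns the evaluation of b ⊗ a into that of b followed by that of a *)
transitivity (((cap a ⊙ wire v) ⊚ (wire a^* ⊙ (cap b ⊙ wire (a ⊗ v)))) ⊚
   (wire a^* ⊙ ((wire b^* ⊙ (cross v (b ⊗ a) ⊚ cross (b ⊗ a) v)) ⊚
     (cross a w ⊙ wire v)))).
  rewrite /block_action /block_mult !comp_atens_wire; try obj.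
  rewrite !acompA -(acompA _ _ ((dualM a b ⊙ _) ⊙ _)) (atensA (dualM a b)).
  rewrite -wireM (@slide_left (dualM a b) _ (b ⊗ a)^* ((b ⊗ a) ⊗ v)) //; try obj.
  rewrite -(@slide_right (dualM a b) _ (a^* ⊗ b^*) ((b ⊗ a) ⊗ v)) //; try obj.
  rewrite (wireM (b ⊗ a) v) -(atensA (dualM a b)) acompA.
  rewrite -comp_atens_wire; last by obj.
  rewrite cap_dualM /nested_cap comp_atens_wire; last by obj.
  rewrite -!acompA; congr (_ ⊚ _).
  by rewrite !(wireM a^*) !(wireM a v) !atensA -!wire_atens_comp //; obj.
have twist : cross v (b ⊗ a) ⊚ cross (b ⊗ a) v =
    (wire b ⊙ cross v a) ⊚ ((cross v b ⊚ cross b v) ⊙ wire a) ⊚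
    (wire b ⊙ cross a v).
  by rewrite crossMr crossMl comp_atens_wire // !acompA.
rewrite [in RHS]/block_action [in RHS]wireM atensA -!acompA.
rewrite -!wire_atens_comp; try obj.
congr (_ ⊚ (_ ⊙ _)).
rewrite twist -/(block_action b v) -[RHS]acompA.
rewrite (@cross_natr _ a (w ⊗ v)); try obj.
rewrite [in RHS]crossMr.
rewrite 2?[wire b^* ⊙ (_ ⊚ (wire b ⊙ _))]wire_atens_comp; try obj.
rewrite [wire b^* ⊙ (_ ⊚ (_ ⊙ wire a))]wire_atens_comp; last by obj.
rewrite -!(atensA (wire b^*) (wire b)) -!wireM -!acompA.
rewrite acompA [in LHS]acompA [in RHS]acompA.
congr (_ ⊚ _).
rewrite (@slide_right (cap b) (cross v a) (b^* ⊗ b)) //.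
rewrite -(@slide_tgt1_left (cap b) (cross v a) (v ⊗ a)) //.
by rewrite wireM -!atensA -acompA -comp_atens_wire //; obj.
Qed.

End StrictCalculus.

(** * Monomial morphisms of families *)

Section Monomial.
Variables (C : braided_ab) (S0 : choiceType).
Implicit Types (f g k : fobj C S0).

(** [F] maps the summand of index [x] to the summand of index [t x], by [A x].
    Stating the entries as arrows avoids transporting them along equations
    between objects. *)
Definition monomial f g (F : fmor f g) (t : supp f -> supp g)
    (A : supp f -> arrow C) : Prop :=
  (forall x, Arr (F x (t x)) = A x) /\ (forall x y, t x <> y -> F x y = 0%R).

Lemma monomial_eq f g (F G : fmor f g) t A t' A' :
  monomial F t A -> monomial G t' A' -> t =1 t' -> A =1 A' -> F = G.
Proof.
move=> [FA F0] [GA G0] tt' AA'; apply: fmor_eq => x y.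
have [e|ne] := pselect (t x = y); last by rewrite F0 // G0 // -tt'.
by subst y; apply: Arr_inj; rewrite FA tt' GA AA'.
Qed.

Lemma monomial_ext f g (F : fmor f g) t A t' A' :
  monomial F t A -> t =1 t' -> A =1 A' -> monomial F t' A'.
Proof.
by move=> [FA F0] tt' AA'; split=> [x|x y ne]; rewrite -?tt' -?AA' ?FA ?F0 ?tt'.
Qed.

Lemma monomial_idf f : monomial (idf f) id (fun x => wire (f x)).
Proof. by split=> [x|x y ne] /=; [rewrite kronxx | rewrite kron_neq]. Qed.

Lemma monomial_compf f g k (G : fmor g k) (F : fmor f g) t A u B :
  monomial G u B -> monomial F t A ->
  monomial (compf G F) (u \o t) (fun x => B (t x) ⊚ A x).
Proof.
move=> [GB G0] [FA F0].
have comp x y : compf G F x y = G (t x) y ∘ F x (t x).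
  rewrite (@compf_seq _ _ _ _ _ _ _ _ _ [:: t x]) ?big_seq1 // => z Fz.
  rewrite inE; apply: contraNT Fz => zt; rewrite F0 // => tz.
  by rewrite tz eqxx in zt.
split=> [x|x y ne]; rewrite comp; first by rewrite Arr_comp GB FA.
by rewrite G0 ?comp0m.
Qed.

Definition mono_entry f g (t : supp f -> supp g) (A : supp f -> arrow C) x y :
    mor (f x) (g y) :=
  if pselect (t x = y) then hom_of (f x) (g y) (A x) else 0%R.

Fact mono_entry_fin f g t A : @row_finite C S0 f g (mono_entry t A).
Proof.
move=> _ x; exists [set t x]; first exact: finite_set1.
by move=> y ne; rewrite /mono_entry; case: pselect => // e; case: ne.
Qed.

Definition mono_mor f g t A : fmor f g := Fmor (@mono_entry_fin f g t A).

Lemma monomial_mono_mor f g (t : supp f -> supp g) A :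
  (forall x, src (A x) = f x) -> (forall x, tgt (A x) = g (t x)) ->
  monomial (mono_mor t A) t A.
Proof.
move=> sA tA; split=> [x|x y ne]; rewrite /= /mono_entry; case: pselect => // e.
exact: Arr_hom_of.
Qed.

Lemma Arr_kron (T : Type) (P : T -> C) a t t' (m : mor a (P t)) :
  t = t' -> Arr (kron t' m) = Arr m.
Proof. by move=> e; subst t'; rewrite kronxx. Qed.

Variables (C_strict : strict C) (gamma : pairing S0) (pt : S0).
Local Notation ppr1 := (@tpr1 _ gamma _ _).
Local Notation ppr2 := (@tpr2 _ gamma _ _).

Lemma monomial_tensfm f f' g g' (F : fmor f f') (G : fmor g g') t A u B :
  monomial F t A -> monomial G u B ->
  monomial (tensfm gamma F G) (fun p => tpair gamma (t (ppr1 p)) (u (ppr2 p)))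
    (fun p => A (ppr1 p) ⊙ B (ppr2 p)).
Proof.
move=> [FA F0] [GB G0]; split=> [p|p q ne] /=.
  by rewrite Arr_tens tpr1K tpr2K FA GB.
have [e1|ne1] := pselect (t (ppr1 p) = ppr1 q); last by rewrite F0 // tens0m.
have [e2|ne2] := pselect (u (ppr2 p) = ppr2 q); last by rewrite G0 // tensm0.
by case: ne; rewrite e1 e2 tpairK.
Qed.

(** The form in which the constraints of the category of families are given:
    [u] and [r] are the coordinates of the row and column indices. *)
Lemma monomial_kron f g (T : Type) (P : T -> C) (F : fmor f g) t A
    (u : supp f -> T) (r : supp g -> T) (m : forall x, mor (f x) (P (u x))) :
  (forall x y, P (r y) = g y /\ Arr (F x y) = Arr (kron (r y) (m x))) ->
  injective r -> (forall x, r (t x) = u x) -> (forall x, Arr (m x) = A x) ->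
  monomial F t A.
Proof.
move=> FE rI rt mA; split=> [x|x y ne].
  by rewrite (FE _ _).2 Arr_kron ?mA.
apply: Arr_inj; rewrite (FE _ _).2 kron_neq ?(FE x y).1 // -rt.
by move=> /rI.
Qed.

Lemma monomial_assocf f g k :
  monomial (assocf gamma f g k)
    (fun p => tpair gamma (ppr1 (ppr1 p)) (tpair gamma (ppr2 (ppr1 p)) (ppr2 p)))
    (fun p => wire (f (ppr1 (ppr1 p)) ⊗ (g (ppr2 (ppr1 p)) ⊗ k (ppr2 p)))).
Proof.
apply: (@monomial_kron _ _ _ (fun v => f v.1.1 ⊗ (g v.1.2 ⊗ k v.2))
  (assocf gamma f g k) _ _
  (@crdl _ _ _ _ _) (@crdr _ _ _ _ _) (fun=> assoc _ _ _)
  (fun x y => conj erefl erefl)); first exact: can_inj (@crdrK _ _ _ _ _).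
  by move=> p; rewrite /crdr !(tpr1K, tpr2K).
by move=> p; rewrite Arr_assoc.
Qed.

Lemma monomial_associf f g k :
  monomial (associf gamma f g k)
    (fun p => tpair gamma (tpair gamma (ppr1 p) (ppr1 (ppr2 p))) (ppr2 (ppr2 p)))
    (fun p => wire ((f (ppr1 p) ⊗ g (ppr1 (ppr2 p))) ⊗ k (ppr2 (ppr2 p)))).
Proof.
apply: (@monomial_kron _ _ _ (fun v => (f v.1.1 ⊗ g v.1.2) ⊗ k v.2)
  (associf gamma f g k) _ _
  (@crdr _ _ _ _ _) (@crdl _ _ _ _ _) (fun=> associ _ _ _)
  (fun x y => conj erefl erefl)); first exact: can_inj (@crdlK _ _ _ _ _).
  by move=> p; rewrite /crdl !(tpr1K, tpr2K).
by move=> p; rewrite Arr_associ.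
Qed.

Lemma monomial_runitf f :
  monomial (runitf gamma pt f) ppr1 (fun p => wire (f (ppr1 p))).
Proof.
apply: (@monomial_kron _ _ _ f (runitf gamma pt f) _ _
  ppr1 id (fun=> runit _)
  (fun x y => conj erefl erefl)) => // p.
by rewrite Arr_runit.
Qed.

Lemma monomial_runitif f :
  monomial (runitif gamma pt f) (fun x => tpair gamma x (ptI pt))
    (fun x => wire (f x ⊗ munit)).
Proof.
apply: (@monomial_kron _ _ _ (fun v => f v ⊗ munit) (runitif gamma pt f) _ _
  id ppr1 (fun=> runiti _)
  (fun x y => conj erefl erefl)).
- exact: can_inj (@rcrdK _ _ _ _).
- by move=> x; rewrite tpr1K.
- by move=> x; rewrite Arr_runiti.
Qed.

Lemma monomial_lunitf f :
  monomial (lunitf gamma pt f) ppr2 (fun p => wire (f (ppr2 p))).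
Proof.
apply: (@monomial_kron _ _ _ f (lunitf gamma pt f) _ _
  ppr2 id (fun=> lunit _)
  (fun x y => conj erefl erefl)) => // p.
by rewrite Arr_lunit.
Qed.

Lemma monomial_lunitif f :
  monomial (lunitif gamma pt f) (fun x => tpair gamma (ptI pt) x)
    (fun x => wire (munit ⊗ f x)).
Proof.
apply: (@monomial_kron _ _ _ (fun v => munit ⊗ f v) (lunitif gamma pt f) _ _
  id ppr2 (fun=> luniti _)
  (fun x y => conj erefl erefl)).
- exact: can_inj (@lcrdK _ _ _ _).
- by move=> x; rewrite tpr2K.
- by move=> x; rewrite Arr_luniti.
Qed.

Lemma monomial_braidf f g :
  monomial (braidf gamma f g) (fun p => tpair gamma (ppr2 p) (ppr1 p))
    (fun p => cross (f (ppr1 p)) (g (ppr2 p))).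
Proof.
apply: (@monomial_kron _ _ _ (fun v => g v.2 ⊗ f v.1) (braidf gamma f g) _ _
  (@tpr _ _ _ _) (@swp _ _ _ _) (fun=> braid _ _)
  (fun x y => conj erefl erefl)) => //.
- exact: can_inj (@swpK _ _ _ _).
- by move=> p; rewrite /swp tpr1K tpr2K.
Qed.

#[local] Hint Resolve monomial_idf monomial_compf monomial_tensfm monomial_assocf
  monomial_associf monomial_braidf : monomial.

(** The map that exchanges the two middle factors in the product of a tensor
    square. Its five constraint factors reduce to one crossing between wires. *)
Definition middle_swap f g k l :
    fmor (tensf gamma (tensf gamma f g) (tensf gamma k l))
      (tensf gamma (tensf gamma f k) (tensf gamma g l)) :=
  compf (compf (compf (compf
    (assocf gamma (tensf gamma f k) g l)
    (tensfm gamma (associf gamma f k g) (idf l)))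
    (tensfm gamma (tensfm gamma (idf f) (braidf gamma g k)) (idf l)))
    (tensfm gamma (assocf gamma f g k) (idf l)))
    (associf gamma (tensf gamma f g) k l).

Lemma monomial_middle_swap f g k l :
  monomial (middle_swap f g k l)
    (fun p => tpair gamma (tpair gamma (ppr1 (ppr1 p)) (ppr1 (ppr2 p)))
                          (tpair gamma (ppr2 (ppr1 p)) (ppr2 (ppr2 p))))
    (fun p => wire (f (ppr1 (ppr1 p))) ⊙
              cross (g (ppr2 (ppr1 p))) (k (ppr1 (ppr2 p))) ⊙
              wire (l (ppr2 (ppr2 p)))).
Proof.
rewrite /middle_swap; apply: monomial_ext; first by eauto 20 with monomial.
  by move=> p; rewrite /= ?(tpr1K, tpr2K).
move=> p; rewrite /= ?(tpr1K, tpr2K) -!wireM !(atensA C_strict).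
by rewrite !wire_acomp ?acomp_wire //= !(tensoA C_strict).
Qed.

End Monomial.

#[local] Hint Resolve monomial_idf monomial_compf monomial_tensfm monomial_assocf
  monomial_associf monomial_runitf monomial_runitif monomial_lunitf
  monomial_lunitif monomial_middle_swap : monomial.

(** * The bialgebra *)

Section DualFamily.
Variables (C : braided_ab) (C_strict : strict C) (D : left_duality C).
Variables (S0 : choiceType) (gamma : pairing S0) (pt : S0) (xpt : C -> S0).
Variables (Sh : set S0) (h : Sh -> C) (h_inj : injective h).
(* the factors are reversed, as in the product of the blocks *)
Variables (e : Sh) (h_e : h e = munit).
Variables (op : Sh -> Sh -> Sh) (h_op : forall x y, h (op x y) = h y ⊗ h x).

Local Notation H := (hbar D gamma h).
Local Notation base := (@hbar_point _ gamma Sh).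
Local Notation letter p := (h (base p)).
Local Notation ppr1 := (@tpr1 _ gamma _ _).
Local Notation ppr2 := (@tpr2 _ gamma _ _).
Local Notation unitf := (unitf C pt).
Local Notation "f ⊗f g" := (tensf gamma f g) (at level 40, left associativity).
Local Notation "F ⊠f G" := (tensfm gamma F G) (at level 40, left associativity).

Fact dpoint_mem (x : Sh) : gamma (val x, val x) \in gamma @` diagset Sh.
Proof.
apply: mem_set; exists (val x, val x) => //.
by exists (val x) => //; apply: set_mem; exact: valP.
Qed.

Definition dpoint (x : Sh) : supp H :=
  exist _ (gamma (val x, val x)) (dpoint_mem x).

Lemma dpointK x : base (dpoint x) = x.
Proof. by apply: val_inj; rewrite /= pair_funK. Qed.

Lemma hbar_pointK p : dpoint (base p) = p.
Proof.
apply: val_inj; case: p => p /= pS; have [_ [x _ <-] <-] := set_mem pS.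
by rewrite pair_funK.
Qed.

Lemma op_assoc x y z : op (op x y) z = op x (op y z).
Proof. by apply: h_inj; rewrite !h_op (tensoA C_strict). Qed.

Lemma op_unit_left x : op e x = x.
Proof. by apply: h_inj; rewrite h_op h_e (tenso1 C_strict). Qed.

Lemma op_unit_right x : op x e = x.
Proof. by apply: h_inj; rewrite h_op h_e (tens1o C_strict). Qed.

Definition hmu : fmor (H ⊗f H) H :=
  @mono_mor _ _ (H ⊗f H) H
    (fun p => dpoint (op (base (ppr1 p)) (base (ppr2 p))))
    (fun p => block_mult D (letter (ppr1 p)) (letter (ppr2 p))).

Definition heta : fmor unitf H :=
  @mono_mor _ _ unitf H (fun=> dpoint e) (fun=> cup D munit).

Definition hDelta : fmor H (H ⊗f H) :=
  @mono_mor _ _ H (H ⊗f H) (fun p => tpair gamma p p)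
    (fun p => block_comult D (letter p)).

Definition heps : fmor H unitf :=
  @mono_mor _ _ H unitf (fun=> ptI pt) (fun p => cap D (letter p)).

Definition hact (V : C) : fmor (H ⊗f J xpt V) (J xpt V) :=
  @mono_mor _ _ (H ⊗f J xpt V) (J xpt V) ppr2
    (fun p => block_action D (letter (ppr1 p)) V).

Local Ltac obj :=
  by rewrite /= ?(src_dualM, tgt_dualM, dpointK, tpr1K, tpr2K, h_op, h_e)
     ?(tensoA C_strict, tenso1 C_strict, tens1o C_strict).

Lemma monomial_hmu : monomial hmu
  (fun p => dpoint (op (base (ppr1 p)) (base (ppr2 p))))
  (fun p => block_mult D (letter (ppr1 p)) (letter (ppr2 p))).
Proof.
apply: monomial_mono_mor => p; first by obj.
by rewrite /= dpointK h_op tgt_dualM.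
Qed.

Lemma monomial_heta : monomial heta (fun=> dpoint e) (fun=> cup D munit).
Proof. by apply: monomial_mono_mor => p; obj. Qed.

Lemma monomial_hDelta : monomial hDelta
  (fun p => tpair gamma p p) (fun p => block_comult D (letter p)).
Proof. by apply: monomial_mono_mor => p; obj. Qed.

Lemma monomial_heps :
  monomial heps (fun=> ptI pt) (fun p => cap D (letter p)).
Proof. by apply: monomial_mono_mor => p; obj. Qed.

Lemma monomial_hact V : monomial (hact V)
  ppr2 (fun p => block_action D (letter (ppr1 p)) V).
Proof. by apply: monomial_mono_mor => p; obj. Qed.

#[local] Hint Resolve monomial_hmu monomial_heta monomial_hDelta monomial_heps
  monomial_hact : monomial.

Local Ltac compare_entries :=
  apply: monomial_eq; [by eauto 20 with monomial | by eauto 20 with monomial | |]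
  => p; rewrite /= ?(tpr1K, tpr2K).

Lemma hmu_assoc :
  compf hmu (idf H ⊠f hmu) =
  compf (compf hmu (hmu ⊠f idf H)) (associf gamma H H H).
Proof.
compare_entries; rewrite !dpointK; first by rewrite op_assoc.
rewrite !h_op [RHS]acomp_wire; last by obj.
by rewrite mult_assoc.
Qed.

Lemma hmu_unit_left :
  idf H = compf (compf hmu (heta ⊠f idf H)) (lunitif gamma pt H).
Proof.
compare_entries; first by rewrite /= dpointK op_unit_left hbar_pointK.
rewrite dpointK h_e [RHS]acomp_wire; last by obj.
by rewrite mult_unit_left.
Qed.

Lemma hmu_unit_right : compf hmu (idf H ⊠f heta) = runitf gamma pt H.
Proof.
compare_entries; first by rewrite /= dpointK op_unit_right hbar_pointK.
by rewrite dpointK h_e mult_unit_right.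
Qed.

Lemma hDelta_coassoc :
  compf (idf H ⊠f hDelta) hDelta =
  compf (assocf gamma H H H) (compf (hDelta ⊠f idf H) hDelta).
Proof.
compare_entries; first by [].
rewrite [RHS]wire_acomp; last by obj.
by rewrite comult_coassoc.
Qed.

Lemma hDelta_counit_left :
  idf H = compf (lunitf gamma pt H) (compf (heps ⊠f idf H) hDelta).
Proof.
compare_entries; first by [].
rewrite [RHS]wire_acomp; last by obj.
by rewrite counit_left.
Qed.

Lemma hDelta_counit_right :
  compf (idf H ⊠f heps) hDelta = runitif gamma pt H.
Proof.
compare_entries; first by [].
by rewrite counit_right // (tenso1 C_strict).
Qed.

Lemma hmu_hDelta :
  compf (compf (hmu ⊠f hmu) (middle_swap gamma H H H H)) (hDelta ⊠f hDelta) =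
  compf hDelta hmu.
Proof.
compare_entries; first by [].
by rewrite dpointK h_op -mult_comult.
Qed.

Lemma heps_hmu :
  heps ⊠f heps = compf (runitif gamma pt unitf) (compf heps hmu).
Proof.
compare_entries; first by [].
by rewrite dpointK h_op counit_mult // [RHS]wire_acomp //; obj.
Qed.

Lemma hact_hmu V :
  compf (hact V) (idf H ⊠f hact V) =
  compf (compf (hact V) (hmu ⊠f idf (J xpt V))) (associf gamma H H (J xpt V)).
Proof.
compare_entries; first by [].
rewrite dpointK h_op [RHS]acomp_wire; last by obj.
by rewrite action_mult.
Qed.

Lemma hact_heta V :
  idf (J xpt V) =
  compf (compf (hact V) (heta ⊠f idf (J xpt V))) (lunitif gamma pt (J xpt V)).
Proof.
compare_entries; first by [].
rewrite dpointK h_e [RHS]acomp_wire; last by obj.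
by rewrite action_unit.
Qed.

Local Notation CS0 := (fobj_braided C gamma pt).

(** The relation between the two sides of each axiom is witnessed by the
    associativity or unit constraint that makes their end points agree. *)
Lemma hbar_bialgebra : @is_bialgebra CS0 H hmu heta hDelta heps.
Proof.
split; first split.
- exists (idm _), (associ _ _ _); split; [exact: can_id|exact: can_associ|].
  by rewrite comp1m; exact: hmu_assoc.
- exists (idm _), (luniti _); split; [exact: can_id|exact: can_luniti|].
  by rewrite comp1m; exact: hmu_unit_left.
- exists (idm _), (runit _); split; [exact: can_id|exact: can_runit|].
  by rewrite !comp1m; exact: hmu_unit_right.
- split.
  + exists (assoc _ _ _), (idm _); split; [exact: can_assoc|exact: can_id|].
    by rewrite compm1; exact: hDelta_coassoc.
  + exists (lunit _), (idm _); split; [exact: can_lunit|exact: can_id|].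
    by rewrite compm1; exact: hDelta_counit_left.
  + exists (runiti _), (idm _); split; [exact: can_runiti|exact: can_id|].
    by rewrite !compm1; exact: hDelta_counit_right.
- exists (idm _), (idm _); split; [exact: can_id|exact: can_id|].
  rewrite comp1m compm1; apply: etrans (esym hmu_hDelta) _.
  by rewrite /middle_swap !compfA.
- exists (runiti _), (idm _); split; [exact: can_runiti|exact: can_id|].
  by rewrite compm1; exact: heps_hmu.
Qed.

Lemma J_module V : @is_module CS0 H hmu heta (J xpt V).
Proof.
exists (hact V); split.
- exists (idm _), (associ _ _ _); split; [exact: can_id|exact: can_associ|].
  by rewrite comp1m; exact: hact_hmu.
- exists (idm _), (luniti _); split; [exact: can_id|exact: can_luniti|].
  by rewrite comp1m; exact: hact_heta.
Qed.

End DualFamily.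

Unset Implicit Arguments.

Theorem theorem2p1 (C : braided_ab) (C_strict : strict C) (D : left_duality C)
    (S0 : choiceType) (S0_infinite : infinite_set [set: S0])
    (gamma : pairing S0) (pt : S0) (xpt : C -> S0)
    (Sh : set S0) (h : Sh -> C) (h_inj : injective h)
    (h_unit : exists x : Sh, h x = munit)
    (h_tens : forall x y : Sh, exists z : Sh, h x ⊗ h y = h z) :
  let CS0 : braided := fobj_braided C gamma pt in
  let H : CS0 := hbar D gamma h in
  exists (mu : mor (H ⊗ H) H) (eta : mor munit H)
         (Delta : mor H (H ⊗ H)) (eps : mor H munit),
    is_bialgebra mu eta Delta eps /\
    forall V : C, @is_module CS0 H mu eta (J xpt V).
Proof.
move=> CS0 H; have [e h_e] := h_unit.
(* the product of the blocks of a and b lies in the block of b ⊗ a *)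
have op_exists x y : {z : Sh | h y ⊗ h x = h z} by exact/cid.
pose op x y := sval (op_exists x y).
have h_op x y : h (op x y) = h y ⊗ h x by rewrite -(svalP (op_exists x y)).
exists (hmu D gamma h op), (heta D gamma pt h e), (hDelta D gamma h),
  (heps D gamma pt h).
split; first exact: hbar_bialgebra.
by move=> V; exact: J_module.
Qed.
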